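(* Let $B\subset W$ be a good lattice and $n\in\mathbb{N}$. (i) If $\varphi\in\mathcal{H}_n$, the function $\varphi^B$ defined on $\varpi^{-(n+1)}B$ by $\varphi^B(x)=\varphi(p_{\mathrm{b}_{2n+1}}(\varpi^{n+1}x))$ is an element of $\mathcal{H}^B_n$. (ii) The map $\varphi\mapsto\varphi^B$ is an isomorphism of $\mathcal{H}_n$ onto $\mathcal{H}^B_n$ intertwining the representations $S^{\mathrm{u},\sigma}\circ p_{Sp(\mathrm{b}_{2n+1})}$ and $S^{B,n}_\psi$ of $K_B$. (iii) Let $x\in\varpi^{-(n+1)}B$ and $\varphi\in\mathcal{H}_n$. Then the support of $\varphi^B$ is contained in $K_Bx$ if and only if the support of $\varphi$ is contained in the orbit of $p_{\mathrm{b}_{2n+1}}(\varpi^{n+1}x)$ modulo $\mathrm{u}^\perp$ under the action of $Sp(\mathrm{b}_{2n+1})$.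
   Context: $k$ is a non-archimedean local field of characteristic $0$ with ring of integers $\mathcal{O}$, uniformizer $\varpi$, residue field $\mathbb{F}_q$ of characteristic $p\neq2$; $\psi$ is a non-trivial unitary character of $(k,+)$ with conductor $\lambda_\psi$ (trivial on $\varpi^{\lambda_\psi}\mathcal{O}$, not on $\varpi^{\lambda_\psi-1}\mathcal{O}$); $\overline\psi$ is the character of $\mathbb{F}_q$ with $\overline\psi(x\bmod\varpi)=\psi(\varpi^{\lambda_\psi-1}x)$. $(W,\beta)$ is a symplectic $k$-space of dimension $2r$. A lattice is a compact open $\mathcal{O}$-submodule; $B^*=\{v\in W:\beta(v,b)\in\varpi^{\lambda_\psi}\mathcal{O}\ \forall b\in B\}$; $B$ is good if $\varpi B^*\subset B\subset B^*$. $K_B$ is the stabilizer of $B$ in $Sp(W)$, and $K_Bx$ is the $K_B$-orbit of $x\in W$. $\mathrm{b}^*=B^*/B$ is an $\mathbb{F}_q$-space with symplectic form $\beta_{\mathrm b^*}=\varpi^{1-\lambda_\psi}\beta\bmod\varpi$; $p_{Sp(\mathrm{b}^* )}:K_B\to Sp(\mathrm{b}^* )$ is the induced morphism. $\rho_{\overline\psi}$ is the Schrödinger representation (irreducible, central character $\overline\psi$) of the Heisenberg group $H(\mathrm{b}^* )=\mathrm{b}^*\times\mathbb{F}_q$, $(w,t)(w',t')=(w+w',t+t'+\frac12\beta_{\mathrm b^*}(w,w'))$, on a space $\mathcal{H}_{\overline\psi}$, and $S_{\overline\psi}$ is the Weil representation of $Sp(\mathrm{b}^* )$ on $\mathcal{H}_{\overline\psi}$,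 i.e. a representation with $S_{\overline\psi}(g)\rho_{\overline\psi}(w,t)S_{\overline\psi}(g)^{-1}=\rho_{\overline\psi}(gw,t)$ (it is unique except when $q=3$ and $\dim\mathrm b^*=2$, in which case a fixed canonical choice is made). Put $\widetilde\rho_{\overline\psi}(b)=\rho_{\overline\psi}(b+B,0)$ for $b\in B^*$ and $\widetilde S_{\overline\psi}=S_{\overline\psi}\circ p_{Sp(\mathrm{b}^* )}$. $\mathcal{H}^B_n$ is the space of functions $\varphi:\varpi^{-(n+1)}B\to\mathcal{H}_{\overline\psi}$ with $\varphi(b+w)=\psi(\frac12\beta(w,b))\widetilde\rho_{\overline\psi}(b)\varphi(w)$ for $b\in B^*$, $w\in\varpi^{-(n+1)}B$ (extended by $0$, these are the elements supported in $\varpi^{-(n+1)}B$ of the generalized lattice model of the Weil representation), and $S_\psi^{B,n}$ is the representation of $K_B$ on it given by $S^{B,n}_\psi(g)\varphi(w)=\widetilde S_{\overline\psi}(g)[\varphi(g^{-1}w)]$. $O_{2n+1}=\mathcal{O}/\varpi^{2n+2}\mathcal{O}$; $\mathrm{b}_{2n+1}=B/\varpi^{2(n+1)}B^*$ with projection $p_{\mathrm{b}_{2n+1}}:B\to \mathrm{b}_{2n+1}$ and $O_{2n+1}$-valued symplectic form $\beta_{\mathrm{b}_{2n+1}}(\bar v,\bar w)=\varpi^{-\lambda_\psi}\beta(v,w)\bmod\varpi^{2n+2}$; $p_{Sp(\mathrm{b}_{2n+1})}:K_B\to Sp(\mathrm{b}_{2n+1})$ is the natural (surjective) morphism. $\psi_{2n+1}$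 is the character of $O_{2n+1}$ with $\psi_{2n+1}(t\bmod\varpi^{2n+2})=\psi(\varpi^{\lambda_\psi-2(n+1)}t)$. $\mathrm{u}=\varpi^{n+1}B/\varpi^{2(n+1)}B^*$, $\mathrm{u}^\perp=\varpi^{n+1}B^*/\varpi^{2(n+1)}B^*$, and $\mathrm{u}^\perp/\mathrm{u}$ is identified with $\mathrm{b}^*$ by division by $\varpi^{n+1}$; $r_{\mathrm{u}}:Sp(\mathrm{b}_{2n+1})\to Sp(\mathrm{u}^\perp/\mathrm{u})=Sp(\mathrm{b}^* )$ is the natural morphism, $\sigma=S_{\overline\psi}\circ r_{\mathrm{u}}$. For $y\in\mathrm{u}^\perp$, $y=p_{\mathrm{b}_{2n+1}}(\varpi^{n+1}b)$ with $b\in B^*$, put $\rho_{\mathrm{u}^\perp}(y)=\rho_{\overline\psi}(b+B,0)$. $\mathcal{H}_n$ is the space of functions $\varphi:\mathrm{b}_{2n+1}\to\mathcal{H}_{\overline\psi}$ with $\varphi(x+y)=\psi_{2n+1}(\frac12\beta_{\mathrm{b}_{2n+1}}(x,y))\rho_{\mathrm{u}^\perp}(y)\varphi(x)$ for $x\in\mathrm{b}_{2n+1}$, $y\in\mathrm{u}^\perp$, and $S^{\mathrm{u},\sigma}(g)\varphi(x)=\sigma(g)[\varphi(g^{-1}x)]$ for $g\in Sp(\mathrm{b}_{2n+1})$ (a Weil representation of $Sp(\mathrm{b}_{2n+1})$ of type $\psi_{2n+1}$). The orbit of $y\in\mathrm{b}_{2n+1}$ modulo $\mathrm{u}^\perp$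 under $Sp(\mathrm{b}_{2n+1})$ is the set $Sp(\mathrm{b}_{2n+1})\cdot y+\mathrm{u}^\perp$.
   Formalization: Part (iii) as written fails for x in B^* (e.g. x = 0 and φ ≠ 0 supported on u^⊥, where φ^B has support B^* ); the formal version proves it as stated for x not in B^*, and for all x in ϖ^{-(n+1)}B with K_B x replaced by K_B x + B^*. *)

(* Defs.v *)
From HB Require Import structures.
From mathcomp Require Import all_boot all_order all_algebra.
From mathcomp Require Import sesquilinear generic_quotient ring_quotient.
From mathcomp Require Import complex zify.
From mathcomp Require Import all_classical all_reals topology normedtype.

Set Implicit Arguments.
Unset Strict Implicit.
Unset Printing Implicit Defensive.

Import Order.TTheory GRing.Theory Num.Theory.
Import numFieldNormedType.Exports.

Local Open Scope ring_scope.
Local Open Scope quotient_scope.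

(* [lval] is the normalised discrete valuation; its value at 0 is irrelevant. *)
HB.mixin Record Field_isNonarchLocal (k : Type) of GRing.Field k := {
  lval : k -> int;
  lvalM : forall x y : k, x != 0 -> y != 0 -> lval (x * y) = lval x + lval y;
  lvalD : forall x y : k, x != 0 -> y != 0 -> x + y != 0 ->
    Num.min (lval x) (lval y) <= lval (x + y);
  lval_onto : exists2 x : k, x != 0 & lval x = 1;
  lval_complete : forall u : nat -> k,
    (forall m : int, exists N : nat, forall i j : nat,
       (N <= i)%N -> (N <= j)%N -> u i - u j = 0 \/ m <= lval (u i - u j)) ->
    exists l : k, forall m : int, exists N : nat, forall i : nat,
       (N <= i)%N -> u i - l = 0 \/ m <= lval (u i - l);
  lval_residue_finite : exists s : seq k, forall x : k,
    x = 0 \/ 0 <= lval x ->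
    exists2 y, y \in s & x - y = 0 \/ 1 <= lval (x - y)
}.

#[short(type="localFieldType")]
HB.structure Definition NonarchLocalField :=
  { k of GRing.Field k & Field_isNonarchLocal k }.

Section Integers.
Variable k : localFieldType.
Implicit Types (x y : k) (m : int).

(* x belongs to the fractional ideal of elements of valuation at least m *)
Definition vge m x := (x == 0) || (m <= lval x).

Lemma lval1 : lval (1 : k) = 0.
Proof.
by have := lvalM _ _ (oner_neq0 k) (oner_neq0 k); rewrite mulr1 -{1}[lval 1]addr0 => /addrI.
Qed.

Lemma vge0 m : vge m (0 : k). Proof. by rewrite /vge eqxx. Qed.

Lemma vgeD m x y : vge m x -> vge m y -> vge m (x + y).
Proof.
rewrite /vge; case: (eqVneq x 0) => [->|x0] /=; first by rewrite add0r.
case: (eqVneq y 0) => [->|y0] /=; first by rewrite addr0 (negbTE x0).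
case: (eqVneq (x + y) 0) => //= xy0 mx my.
by apply: le_trans (lvalD _ _ x0 y0 xy0); rewrite le_min mx my.
Qed.

Lemma vgeM m1 m2 x y : vge m1 x -> vge m2 y -> vge (m1 + m2) (x * y).
Proof.
rewrite /vge mulf_eq0; case: (eqVneq x 0) => //= x0.
case: (eqVneq y 0) => //= y0 m1x m2y.
by rewrite lvalM // lerD.
Qed.

Lemma lvalN1 : lval (-1 : k) = 0.
Proof.
have N10 : (-1 : k) != 0 by rewrite oppr_eq0 oner_neq0.
have := lvalM _ _ N10 N10; rewrite mulrNN mulr1 lval1 => /esym/eqP.
by rewrite -mulr2n mulrn_eq0 /= => /eqP.
Qed.

Lemma vgeN m x : vge m x -> vge m (- x).
Proof.
move=> mx; rewrite -mulN1r -[m]add0r; apply: vgeM => //.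
by rewrite /vge lvalN1 lexx orbT.
Qed.

Lemma vge_le m1 m2 x : m2 <= m1 -> vge m1 x -> vge m2 x.
Proof. by rewrite /vge => m12 /orP[->//|/(le_trans m12)->]; rewrite orbT. Qed.

Definition valring : {pred k} := [pred x | vge 0 x].

Lemma valring_closed : subring_closed valring.
Proof.
split=> [|x y x0 y0|x y x0 y0]; rewrite inE.
- by rewrite /vge lval1 lexx orbT.
- exact/vgeD/vgeN.
- by rewrite -[0]addr0; apply: vgeM.
Qed.

HB.instance Definition _ := GRing.isSubringClosed.Build k valring valring_closed.

Record integers := Integer { int_val :> k; _ : int_val \in valring }.

HB.instance Definition _ := [isSub for int_val].
HB.instance Definition _ := [Choice of integers by <:].
HB.instance Definition _ := [SubChoice_isSubComNzRing of integers by <:].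

(* the ideal of exponent m + 1 *)
Definition ideal_pow (m : nat) : {pred integers} :=
  [pred x | vge m.+1%:Z (\val x)].

Lemma ideal_pow_closed (m : nat) : idealr_closed (ideal_pow m).
Proof.
split=> [||a x y xm ym]; rewrite ?inE.
- exact: vge0.
- by rewrite /vge /= oner_eq0 lval1.
- rewrite /=; apply: vgeD => //; rewrite -[m.+1%:Z]add0r; apply: vgeM => //.
  exact: (valP a).
Qed.

HB.instance Definition _ (m : nat) :=
  isIdealr.Build integers (ideal_pow m) (ideal_pow_closed m).

(* the ring O_m of integers modulo the ideal of exponent m + 1 *)
Definition Oquot (m : nat) := {ideal_quot (ideal_pow m)}.

HB.instance Definition _ (m : nat) := GRing.ComNzRing.on (Oquot m).

Definition residue_field := Oquot 0.

(* Only used on elements of the valuation ring. *)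
Definition to_int x : integers := insubd (0 : integers) x.

Definition Oclass (m : nat) x : Oquot m := \pi_(Oquot m) (to_int x).

Lemma to_intK x : vge 0 x -> \val (to_int x) = x.
Proof. by move=> x0; rewrite /to_int insubdK. Qed.

Record uniformizer := Uniformizer {
  unif_val :> k;
  unif_neq0 : unif_val != 0;
  lval_unif : lval unif_val = 1
}.

End Integers.

Section Topology.
Variables (k : localFieldType) (W : vectType k).
Local Open Scope classical_set_scope.

(* W with the product topology given by coordinates on a basis. *)
Definition vtop : Type := W.

HB.instance Definition _ := Choice.on vtop.

Definition vbox (m : int) : set W :=
  [set w | forall i, vge m (coord (vbasis {:W}) i w)].

Definition vopen : set_system vtop :=
  [set U | forall x : W, U x ->
     exists m : int, forall y : W, vbox m y -> U (x + y)].

Lemma vopenT : vopen setT. Proof. by exists 0. Qed.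

Lemma vopenI : setI_closed vopen.
Proof.
move=> U V oU oV x [Ux Vx]; have [m mU] := oU x Ux; have [m' mV] := oV x Vx.
exists (Num.max m m') => y ym; split; [apply: mU|apply: mV] => i;
  by apply: vge_le (ym i); rewrite le_max lexx ?orbT.
Qed.

Lemma vopen_bigU (I : Type) (f : I -> set vtop) :
  (forall i, vopen (f i)) -> vopen (\bigcup_i f i).
Proof.
move=> fo x [i _ fx]; have [m mf] := fo i x fx.
by exists m => y my; exists i => //; apply: mf.
Qed.

HB.instance Definition _ := isOpenTopological.Build vtop vopenT vopenI vopen_bigU.

End Topology.

Section Characters.
Variables (R : realType) (k : localFieldType).
Implicit Type psi : k -> R[i].

Record unitary_character psi : Prop := {
  char_add : forall x y, psi (x + y) = psi x * psi y;
  char_unitary : forall x, `|psi x| = 1;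
  char_continuous : continuous (psi : vtop k^o -> R[i]^o)
}.

Definition has_conductor psi (lam : int) :=
  (forall x, vge lam x -> psi x = 1) /\ (exists2 x, vge (lam - 1) x & psi x != 1).

End Characters.

Section Submodules.
Variables (k : localFieldType) (W : vectType k).

Record omod := OMod {
  omod_pred :> {pred W};
  omod_zmod : zmod_closed omod_pred;
  omod_scale : forall (a : integers k) (x : W),
    x \in omod_pred -> \val a *: x \in omod_pred
}.

HB.instance Definition _ (A : omod) :=
  GRing.isZmodClosed.Build W (omod_pred A) (omod_zmod A).

Record omod_elt (A : omod) := OElt { oelt_val :> W; _ : oelt_val \in A }.

HB.instance Definition _ (A : omod) := [isSub of omod_elt A for @oelt_val A].
HB.instance Definition _ (A : omod) := [Choice of omod_elt A by <:].
HB.instance Definition _ (A : omod) := [SubChoice_isSubZmodule of omod_elt A by <:].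

Definition oscale (A : omod) (a : integers k) (x : omod_elt A) : omod_elt A :=
  OElt (omod_scale a (valP x)).

(* Only used on elements of A. *)
Definition to_omod (A : omod) (x : W) : omod_elt A := insubd (0 : omod_elt A) x.

Lemma to_omodK (A : omod) (x : W) : x \in A -> \val (to_omod A x) = x.
Proof. by move=> xA; rewrite /to_omod insubdK. Qed.

Variable pi : uniformizer k.

Definition upow (m : int) : k := unif_val pi ^ m.

Lemma upowD m m' : upow (m + m') = upow m * upow m'.
Proof. by rewrite /upow expfzDr // unif_neq0. Qed.

Lemma upow0 : upow 0 = 1. Proof. by []. Qed.

Lemma upowN m : upow m * upow (- m) = 1.
Proof. by rewrite -upowD subrr. Qed.

Lemma upow_vge m : vge m (upow m).
Proof.
rewrite /vge /upow; apply/orP; right.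
have natE : forall i : nat, lval (unif_val pi ^+ i) = i%:Z.
  elim=> [|i IH]; first by rewrite expr0 lval1.
  by rewrite exprS lvalM ?expf_neq0 ?unif_neq0 // lval_unif IH.
case: m => i; first by rewrite -exprnP natE.
rewrite NegzE -exprnN.
have n0 : unif_val pi ^+ i.+1 != 0 by rewrite expf_neq0 ?unif_neq0.
have := lvalM _ _ n0 (invr_neq0 n0); rewrite divff // lval1 natE => /esym/eqP.
by rewrite addrC addr_eq0 => /eqP ->.
Qed.

(* the submodule pi ^ m A *)
Definition scale_pred (m : int) (A : omod) : {pred W} :=
  [pred v | upow (- m) *: v \in A].

Lemma scale_zmod m A : zmod_closed (scale_pred m A).
Proof.
split=> [|x y xA yA]; rewrite inE; first by rewrite scaler0 rpred0.
by rewrite scalerBr rpredB.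
Qed.

Lemma scale_scale m A (a : integers k) (x : W) :
  x \in scale_pred m A -> \val a *: x \in scale_pred m A.
Proof. by rewrite !inE scalerA mulrC -scalerA; apply: omod_scale. Qed.

Definition scale_omod m A := OMod (scale_zmod m A) (@scale_scale m A).

Lemma mem_scale_omod m (A : omod) x :
  (x \in scale_omod m A) = (upow (- m) *: x \in A).
Proof. by []. Qed.

Lemma in_scale_omod m (A : omod) x :
  (upow m *: x \in scale_omod m A) = (x \in A).
Proof. by rewrite mem_scale_omod scalerA mulrC upowN scale1r. Qed.

Lemma scale_omod_sub m A x : 0 <= m -> x \in scale_omod m A -> x \in A.
Proof.
move=> m0 xA; have pm0 : upow m \in @valring k.
  exact: vge_le m0 (upow_vge m).
have := @omod_scale A (Integer pm0) (upow (- m) *: x) xA.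
by rewrite /= scalerA upowN scale1r.
Qed.

Variable beta : {skew_symmetric W}.

Lemma beta_skew x y : beta x y = - beta y x.
Proof. by rewrite hermC /= expr1 mulN1r. Qed.

Lemma betaZr a x y : beta x (a *: y) = a * beta x y.
Proof. by rewrite linearZ. Qed.

Lemma betaZl a x y : beta (a *: x) y = a * beta x y.
Proof. by rewrite linearZl_LR. Qed.

Lemma betaBl x y z : beta (x - y) z = beta x z - beta y z.
Proof. by rewrite linearBl. Qed.

Lemma betaBr x y z : beta x (y - z) = beta x y - beta x z.
Proof. by rewrite linearB. Qed.

Variable lam : int.

Definition dual_pred (A : omod) : {pred W} :=
  [pred v | `[< forall b, b \in A -> vge lam (beta v b) >]].

Lemma dual_predP (A : omod) v :
  reflect (forall b, b \in A -> vge lam (beta v b)) (v \in dual_pred A).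
Proof. exact: asboolP. Qed.

Lemma dual_zmod A : zmod_closed (dual_pred A).
Proof.
split=> [|x y /dual_predP xA /dual_predP yA]; apply/dual_predP => b bA.
  by rewrite linear0l vge0.
by rewrite linearBl; apply: vgeD; [exact: xA|apply: vgeN; exact: yA].
Qed.

Lemma dual_scale A (a : integers k) (x : W) :
  x \in dual_pred A -> \val a *: x \in dual_pred A.
Proof.
move=> /dual_predP xA; apply/dual_predP => b bA.
rewrite betaZl -[lam]add0r; apply: vgeM (xA b bA); exact: (valP a).
Qed.

Definition dual_omod A := OMod (dual_zmod A) (@dual_scale A).

Lemma dual_omodP (A : omod) v :
  reflect (forall b, b \in A -> vge lam (beta v b)) (v \in dual_omod A).
Proof. exact: dual_predP. Qed.

Record good_lattice := GoodLattice {
  glat :> omod;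
  glat_open : open ([set` glat]%classic : set (vtop W));
  glat_compact : compact ([set` glat]%classic : set (vtop W));
  glat_dual_sub : {subset scale_omod 1 (dual_omod glat) <= glat};
  glat_sub_dual : {subset glat <= dual_omod glat}
}.

End Submodules.

Section IsometryGroup.
Variables (R : pzRingType) (M : lmodType R) (T : Type) (f : M -> M -> T).

Record spgroup := SpGroup {
  sp_fun :> M -> M;
  sp_inv : M -> M;
  sp_linear : linear sp_fun;
  sp_funK : cancel sp_fun sp_inv;
  sp_invK : cancel sp_inv sp_fun;
  sp_form : forall x y, f (sp_fun x) (sp_fun y) = f x y
}.

HB.instance Definition _ (g : spgroup) :=
  GRing.isLinear.Build R M M _ (sp_fun g) (sp_linear g).

HB.instance Definition _ := gen_eqMixin spgroup.
HB.instance Definition _ := gen_choiceMixin spgroup.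

Lemma spgroup_eq (g h : spgroup) : g =1 h -> g = h.
Proof.
case: g h => [g g' gl gK g'K gf] [h h' hl hK h'K hf] /= gh.
have {gh}gh : g = h by exact/funext.
case: _ / gh in hl hK h'K hf *.
have E : g' = h' by apply/funext => x; rewrite -[LHS]hK g'K.
by case: _ / E in hK h'K *; congr SpGroup; exact: Prop_irrelevance.
Qed.

Lemma sp_inv_linear (g : spgroup) : linear (sp_inv g).
Proof.
move=> a x y; apply: (can_inj (sp_funK g)).
by rewrite linearP /= !sp_invK.
Qed.

Definition sp_one : spgroup :=
  @SpGroup id id (fun _ _ _ => erefl) (fun _ => erefl) (fun _ => erefl)
    (fun _ _ => erefl).

Section Mul.
Variables g h : spgroup.

Lemma sp_mul_linear : linear (g \o h).
Proof. by move=> a x y; rewrite /= !linearP. Qed.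
Lemma sp_mul_form x y : f ((g \o h) x) ((g \o h) y) = f x y.
Proof. by rewrite /= !sp_form. Qed.
Lemma sp_inv_form x y : f (sp_inv g x) (sp_inv g y) = f x y.
Proof. by rewrite -(sp_form g) !sp_invK. Qed.

Definition sp_mul : spgroup :=
  SpGroup sp_mul_linear (can_comp (sp_funK g) (sp_funK h))
    (can_comp (sp_invK h) (sp_invK g)) sp_mul_form.

Definition sp_opp : spgroup :=
  SpGroup (sp_inv_linear g) (sp_invK g) (sp_funK g) sp_inv_form.

End Mul.

Lemma sp_mulA : associative sp_mul.
Proof. by move=> g h l; apply: spgroup_eq. Qed.
Lemma sp_mul1 : left_id sp_one sp_mul.
Proof. by move=> g; apply: spgroup_eq. Qed.
Lemma sp_1mul : right_id sp_one sp_mul.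
Proof. by move=> g; apply: spgroup_eq. Qed.
Lemma sp_mulV : left_inverse sp_one sp_opp sp_mul.
Proof. by move=> g; apply: spgroup_eq => x /=; rewrite sp_funK. Qed.
Lemma sp_Vmul : right_inverse sp_one sp_opp sp_mul.
Proof. by move=> g; apply: spgroup_eq => x /=; rewrite sp_invK. Qed.

HB.instance Definition _ :=
  isGroup.Build spgroup sp_mulA sp_mul1 sp_1mul sp_mulV sp_Vmul.

End IsometryGroup.

Section Representations.
Variables (C : pzRingType) (G : groupType) (V : lmodType C).
Implicit Type r : G -> {linear V -> V}.

Record is_representation r : Prop := {
  rep1 : forall v, r 1%g v = v;
  repM : forall g h v, r (g * h)%g v = r g (r h v)
}.

Definition irreducible_representation r :=
  (exists v : V, v != 0) /\
  forall U : {pred V}, submod_closed U ->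
    (forall g v, v \in U -> r g v \in U) ->
    (forall v, v \in U -> v = 0) \/ (forall v, v \in U).

End Representations.

Section QuotientModules.
Variables (k : localFieldType) (W : vectType k) (pi : uniformizer k).
Variable beta : {skew_symmetric W}.

(* A symplectic module qnum / qden over the ring O_m of integers modulo
   pi ^ (m + 1), whose O_m-valued form is induced by pi ^ qshift * beta. *)
Record qdatum (m : nat) := QDatum {
  qnum : omod W;
  qden : omod W;
  qshift : int;
  qden_sub : {subset qden <= qnum};
  qden_ann : forall x, x \in qnum -> upow pi m.+1%:Z *: x \in qden;
  qform_int : forall x y, x \in qnum -> y \in qnum ->
    vge 0 (upow pi qshift * beta x y);
  qform_rad : forall x y, x \in qnum -> y \in qden ->
    vge m.+1%:Z (upow pi qshift * beta x y)
}.

Section Quotient.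
Variables (m : nat) (P : qdatum m).

Definition qden_pred : {pred omod_elt (qnum P)} := [pred x | \val x \in qden P].

Lemma qden_zmod : zmod_closed qden_pred.
Proof.
split=> [|x y xP yP]; first by rewrite inE raddf0 rpred0.
by rewrite inE raddfB; apply: rpredB.
Qed.

HB.instance Definition _ := GRing.isZmodClosed.Build _ qden_pred qden_zmod.

Definition qmod := Quotient.quot qden_pred.

HB.instance Definition _ := GRing.Zmodule.on qmod.

(* The class of w; only used for w in qnum. *)
Definition qclass (w : W) : qmod := \pi_qmod (to_omod (qnum P) w).

Definition qrepr (x : qmod) : W := \val (repr x).

Lemma qrepr_num x : qrepr x \in qnum P. Proof. exact: valP. Qed.

Lemma qreprK x : qclass (qrepr x) = x.
Proof.
rewrite -[RHS]reprK /qclass; congr (\pi _); apply: val_inj.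
by rewrite to_omodK ?qrepr_num.
Qed.

Lemma qclass_eq v w : v \in qnum P -> w \in qnum P ->
  (qclass v == qclass w) = (v - w \in qden P).
Proof. by move=> vP wP; rewrite -Quotient.idealrBE inE raddfB /= !to_omodK. Qed.

Lemma qrepr_class v : v \in qnum P -> qrepr (qclass v) - v \in qden P.
Proof. by move=> vP; rewrite -qclass_eq ?qrepr_num // qreprK. Qed.

Lemma qclassD v w : v \in qnum P -> w \in qnum P ->
  qclass (v + w) = qclass v + qclass w.
Proof.
move=> vP wP; rewrite /qclass -raddfD; congr (\pi _); apply: val_inj.
by rewrite raddfD /= !to_omodK // rpredD.
Qed.

Lemma Oclass_eq (x y : k) : vge 0 x -> vge 0 y ->
  (Oclass m x == Oclass m y) = vge m.+1%:Z (x - y).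
Proof. by move=> x0 y0; rewrite -Quotient.idealrBE inE raddfB /= !to_intK. Qed.

Lemma OclassD (x y : k) : vge 0 x -> vge 0 y ->
  Oclass m (x + y) = Oclass m x + Oclass m y.
Proof.
move=> x0 y0; rewrite /Oclass -raddfD; congr (\pi _); apply: val_inj.
by rewrite raddfD /= !to_intK // vgeD.
Qed.

Lemma OclassM (x y : k) : vge 0 x -> vge 0 y ->
  Oclass m (x * y) = Oclass m x * Oclass m y.
Proof.
move=> x0 y0; rewrite /Oclass -rmorphM; congr (\pi _); apply: val_inj.
by rewrite rmorphM /= !to_intK // -[0]addr0 vgeM.
Qed.

Definition Orepr (a : Oquot k m) : k := \val (repr a).

Lemma Orepr_int a : vge 0 (Orepr a). Proof. exact: (valP (repr a)). Qed.

Lemma OreprK a : Oclass m (Orepr a) = a.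
Proof.
rewrite -[RHS]reprK /Oclass; congr (\pi _); apply: val_inj.
by rewrite to_intK ?Orepr_int.
Qed.

Lemma Orepr_class x : vge 0 x -> vge m.+1%:Z (Orepr (Oclass m x) - x).
Proof. by move=> x0; rewrite -Oclass_eq ?Orepr_int // OreprK. Qed.

Lemma qnumZ (a : k) x : vge 0 a -> x \in qnum P -> a *: x \in qnum P.
Proof. by move=> a0 xP; exact: (@omod_scale _ _ _ (Integer a0)). Qed.

Lemma qdenZ (a : k) x : vge 0 a -> x \in qden P -> a *: x \in qden P.
Proof. by move=> a0 xP; exact: (@omod_scale _ _ _ (Integer a0)). Qed.

Lemma qden_annZ (a : k) x : vge m.+1%:Z a -> x \in qnum P -> a *: x \in qden P.
Proof.
move=> am xP; rewrite -[a]mul1r -(upowN pi m.+1%:Z) -mulrA -scalerA.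
apply: qden_ann; apply: qnumZ => //; rewrite -(addNr m.+1%:Z).
exact: vgeM (upow_vge _ _) am.
Qed.

Definition qscale (a : Oquot k m) (x : qmod) : qmod :=
  qclass (Orepr a *: qrepr x).

Lemma qclassZ (a : k) v : vge 0 a -> v \in qnum P ->
  qclass (a *: v) = qscale (Oclass m a) (qclass v).
Proof.
move=> a0 vP; apply/eqP; rewrite /qscale eq_sym.
have ra := Orepr_int (Oclass m a); have rv := qrepr_num (qclass v).
rewrite qclass_eq ?qnumZ //.
rewrite -[X in X - _](subrK (Orepr (Oclass m a) *: v)) -addrA.
rewrite -scalerBr -scalerBl.
apply: rpredD; first by apply: qdenZ => //; apply: qrepr_class.
by apply: qden_annZ => //; apply: Orepr_class.
Qed.

Lemma qscaleA a b x : qscale a (qscale b x) = qscale (a * b) x.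
Proof.
rewrite -[x]qreprK -[a]OreprK -[b]OreprK -OclassM ?Orepr_int //.
rewrite -!qclassZ ?qnumZ ?qrepr_num ?Orepr_int ?scalerA //.
by rewrite -[0]addr0 vgeM ?Orepr_int.
Qed.

Lemma vge01 : vge 0 (1 : k). Proof. by rewrite /vge lval1 lexx orbT. Qed.

Lemma Oclass1 : Oclass m (1 : k) = 1.
Proof.
rewrite /Oclass -[RHS](rmorph1 (\pi_(Oquot k m))); congr (\pi _).
by apply: val_inj; rewrite to_intK ?vge01.
Qed.

Lemma qscale1 : left_id 1 qscale.
Proof. by move=> x; rewrite -[x]qreprK -Oclass1 -qclassZ ?vge01 ?qrepr_num ?scale1r. Qed.

Lemma qscaleDr : right_distributive qscale +%R.
Proof.
move=> a x y; rewrite -[x]qreprK -[y]qreprK -[a]OreprK -qclassD ?qrepr_num //.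
rewrite -!qclassZ ?Orepr_int ?rpredD ?qrepr_num //.
by rewrite -qclassD ?qnumZ ?Orepr_int ?qrepr_num // scalerDr.
Qed.

Lemma qscaleDl x : {morph qscale^~ x : a b / a + b}.
Proof.
move=> a b /=; rewrite -[x]qreprK -[a]OreprK -[b]OreprK -OclassD ?Orepr_int //.
rewrite -!qclassZ ?Orepr_int ?vgeD ?Orepr_int ?qrepr_num //.
by rewrite -qclassD ?qnumZ ?Orepr_int ?qrepr_num // scalerDl.
Qed.

HB.instance Definition _ := GRing.Zmodule_isLmodule.Build (Oquot k m) qmod
  qscaleA qscale1 qscaleDr qscaleDl.

Lemma scale_qclass (a : k) v : vge 0 a -> v \in qnum P ->
  Oclass m a *: qclass v = qclass (a *: v).
Proof. by move=> a0 vP; rewrite qclassZ. Qed.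

Definition qform (x y : qmod) : Oquot k m :=
  Oclass m (upow pi (qshift P) * beta (qrepr x) (qrepr y)).

Lemma qformE v w : v \in qnum P -> w \in qnum P ->
  qform (qclass v) (qclass w) = Oclass m (upow pi (qshift P) * beta v w).
Proof.
move=> vP wP; have rv := qrepr_num (qclass v); have rw := qrepr_num (qclass w).
apply/eqP; rewrite /qform Oclass_eq ?qform_int //.
set c := upow pi _; rewrite -[X in X - _](subrK (c * beta v (qrepr (qclass w)))).
rewrite -addrA -!mulrBr -betaBl -betaBr.
apply: vgeD; last by rewrite qform_rad ?qrepr_class.
by rewrite beta_skew mulrN; apply: vgeN; rewrite qform_rad ?qrepr_class.
Qed.

Lemma qformDl x y z : qform (x + y) z = qform x z + qform y z.
Proof.
rewrite -[x]qreprK -[y]qreprK -[z]qreprK -qclassD ?qrepr_num //.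
rewrite !qformE ?rpredD ?qrepr_num // linearDl mulrDr.
by rewrite OclassD ?qform_int ?qrepr_num.
Qed.

Lemma qformDr x y z : qform x (y + z) = qform x y + qform x z.
Proof.
rewrite -[x]qreprK -[y]qreprK -[z]qreprK -qclassD ?qrepr_num //.
rewrite !qformE ?rpredD ?qrepr_num // linearDr mulrDr.
by rewrite OclassD ?qform_int ?qrepr_num.
Qed.

(* Equal to 1/2 when the residue characteristic is not 2. *)
Definition Ohalf : Oquot k m := Oclass m 2^-1.

Definition heisenberg : Type := (qmod * Oquot k m)%type.

HB.instance Definition _ := Choice.on heisenberg.

Definition heis_mul (h h' : heisenberg) : heisenberg :=
  (h.1 + h'.1, h.2 + h'.2 + Ohalf * qform h.1 h'.1).
Definition heis_one : heisenberg := (0, 0).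
(* The last term vanishes when 2 is invertible in k. *)
Definition heis_inv (h : heisenberg) : heisenberg :=
  (- h.1, - h.2 + Ohalf * qform h.1 h.1).

Lemma qform0l x : qform 0 x = 0.
Proof. by apply: (addrI (qform 0 x)); rewrite -qformDl !addr0. Qed.
Lemma qform0r x : qform x 0 = 0.
Proof. by apply: (addrI (qform x 0)); rewrite -qformDr !addr0. Qed.
Lemma qformNl x y : qform (- x) y = - qform x y.
Proof. by apply: (addrI (qform x y)); rewrite -qformDl !subrr qform0l. Qed.
Lemma qformNr x y : qform x (- y) = - qform x y.
Proof. by apply: (addrI (qform x y)); rewrite -qformDr !subrr qform0r. Qed.

Lemma heis_mulA : associative heis_mul.
Proof.
move=> [x a] [y b] [z c]; rewrite /heis_mul /= addrA; congr pair.
rewrite qformDl qformDr !mulrDr !addrA [RHS]addrAC; congr (_ + _).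
by rewrite [in RHS](addrAC (a + b) _ c) [RHS]addrAC.
Qed.
Lemma heis_1mul : left_id heis_one heis_mul.
Proof. by move=> [x a]; rewrite /heis_mul /= qform0l mulr0 !add0r addr0. Qed.
Lemma heis_mul1 : right_id heis_one heis_mul.
Proof. by move=> [x a]; rewrite /heis_mul /= qform0r mulr0 !addr0. Qed.
Lemma heis_Vmul : left_inverse heis_one heis_inv heis_mul.
Proof.
move=> [x a]; rewrite /heis_mul /= addNr qformNl mulrN addrAC.
by rewrite addrK addNr.
Qed.
Lemma heis_mulV : right_inverse heis_one heis_inv heis_mul.
Proof.
move=> [x a]; rewrite /heis_mul /= subrr qformNr mulrN addrA.
by rewrite addrK subrr.
Qed.

HB.instance Definition _ := isGroup.Build heisenberg
  heis_mulA heis_1mul heis_mul1 heis_Vmul heis_mulV.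

End Quotient.
End QuotientModules.

Notation SpQ P := (spgroup (@qform _ _ _ _ _ P)).

Section InducedIsometry.
Variables (k : localFieldType) (W : vectType k) (pi : uniformizer k).
Variables (beta : {skew_symmetric W}) (m : nat) (P : qdatum pi beta m).
Local Notation Sp := (spgroup beta).

Definition stable (A : omod W) (g : Sp) := forall v, (g v \in A) = (v \in A).

Lemma stable_inv A (g : Sp) : stable A g -> stable A g^-1%g.
Proof. by move=> gA v; rewrite -gA sp_invK. Qed.

Variable g : Sp.
Hypotheses (gnum : stable (qnum P) g) (gden : stable (qden P) g).

Definition quot_fun (h : Sp) (x : qmod P) : qmod P := qclass P (h (qrepr x)).

Lemma quot_funE (h : Sp) v : stable (qnum P) h -> stable (qden P) h ->
  v \in qnum P -> quot_fun h (qclass P v) = qclass P (h v).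
Proof.
move=> hn hd vP; apply/eqP; rewrite qclass_eq ?hn ?qrepr_num //.
by rewrite -linearB hd qrepr_class.
Qed.

Lemma quot_fun_linear : linear (quot_fun g).
Proof.
move=> a x y; rewrite -[x]qreprK -[y]qreprK -[a]OreprK.
set u := qrepr x; set v := qrepr y; set c := Orepr a.
have [uP vP cP] := And3 (qrepr_num x) (qrepr_num y) (Orepr_int a).
rewrite -/u -/v -/c in uP vP cP.
have ZE w : w \in qnum P -> Oclass m c *: qclass P w = qclass P (c *: w).
  exact: scale_qclass.
rewrite ZE // -qclassD ?qnumZ // !quot_funE ?rpredD ?qnumZ //.
by rewrite ZE ?gnum // -qclassD ?qnumZ ?gnum // linearP.
Qed.

Lemma quot_funK : cancel (quot_fun g) (quot_fun g^-1%g).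
Proof.
move=> x; rewrite -[x]qreprK quot_funE ?qrepr_num //.
rewrite quot_funE ?gnum ?qrepr_num //; try exact: stable_inv.
by rewrite /= sp_funK.
Qed.

Lemma quot_funVK : cancel (quot_fun g^-1%g) (quot_fun g).
Proof.
have [gn' gd'] := (stable_inv gnum, stable_inv gden).
move=> x; rewrite -[x]qreprK quot_funE ?qrepr_num //.
by rewrite quot_funE ?gn' ?qrepr_num //= sp_invK.
Qed.

Lemma quot_fun_form x y :
  qform (quot_fun g x) (quot_fun g y) = qform x y.
Proof.
rewrite -[x]qreprK -[y]qreprK !quot_funE ?qrepr_num //.
by rewrite !qformE ?gnum ?qrepr_num // sp_form.
Qed.

Definition quot_isometry : SpQ P :=
  SpGroup quot_fun_linear quot_funK quot_funVK quot_fun_form.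

End InducedIsometry.

Section LatticeModules.
Variables (k : localFieldType) (W : vectType k) (pi : uniformizer k).
Variables (beta : {skew_symmetric W}) (lam : int).
Variable B : good_lattice pi beta lam.
Local Notation Sp := (spgroup beta).
Local Notation Bd := (dual_omod beta lam (glat B)).

Lemma dual_beta x y : x \in Bd -> y \in B -> vge lam (beta x y).
Proof. by move=> /dual_omodP; apply. Qed.

Lemma unif_dual x : x \in Bd -> upow pi 1 *: x \in B.
Proof. by move=> xB; apply: glat_dual_sub; rewrite in_scale_omod. Qed.

Lemma bstar_int x y : x \in Bd -> y \in Bd ->
  vge 0 (upow pi (1 - lam) * beta x y).
Proof.
move=> xB yB; rewrite addrC upowD -mulrA -betaZr -(addNr lam).
exact: vgeM (upow_vge _ _) (dual_beta xB (unif_dual yB)).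
Qed.

Lemma bstar_rad x y : x \in Bd -> y \in B ->
  vge 1 (upow pi (1 - lam) * beta x y).
Proof.
move=> xB yB; rewrite -[X in vge X _](subrK lam).
exact: vgeM (upow_vge _ _) (dual_beta xB yB).
Qed.

(* b* = B^* / B with its form pi ^ (1 - lam) * beta modulo pi *)
Definition bstar : qdatum pi beta 0 :=
  QDatum (@glat_sub_dual _ _ _ _ _ B) unif_dual bstar_int bstar_rad.

(* the stabiliser K_B of B in Sp(W) *)
Definition stabilizer : Type :=
  {g : Sp | ([set g v | v in [set` glat B]] = [set` glat B])%classic}.

Definition stab_elt (g : stabilizer) : Sp := sval g.
Coercion stab_elt : stabilizer >-> spgroup.

Lemma stab_lat (g : stabilizer) : stable (glat B) g.
Proof.
move=> v; case: g => g /= gB; have gBE w : (exists2 u, u \in B & g u = w) <-> w \in B.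
  by have := congr1 (fun A : set W => A w) gB => /= ->.
apply/idP/idP => [/gBE[u uB /(can_inj (sp_funK g))<-]//|vB].
by apply/gBE; exists v.
Qed.

Lemma stab_dual (g : stabilizer) : stable Bd g.
Proof.
move=> v; apply/dual_omodP/dual_omodP => vB b bB.
  by rewrite -(sp_form g); apply: vB; rewrite stab_lat.
rewrite -[b](sp_invK g) sp_form; apply: vB.
by have := stable_inv (stab_lat g) b => /= ->.
Qed.

Lemma stable_scale e (A : omod W) (g : Sp) : stable A g -> stable (scale_omod pi e A) g.
Proof. by move=> gA v; rewrite !mem_scale_omod -linearZ gA. Qed.

Definition pSp_bstar (g : stabilizer) : SpQ bstar :=
  @quot_isometry _ _ _ _ _ bstar g (stab_dual g) (stab_lat g).

Variable n : nat.

Lemma bodd_sub : {subset scale_omod pi (2 * n.+1)%N%:Z Bd <= B}.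
Proof.
move=> x xB; apply: glat_dual_sub; rewrite mem_scale_omod.
apply: (@scale_omod_sub _ _ pi (2 * n.+1 - 1)%N%:Z) => //.
rewrite mem_scale_omod scalerA -upowD.
suff -> : - (2 * n.+1 - 1)%N%:Z + - 1 = - (2 * n.+1)%N%:Z :> int by [].
by rewrite -opprD -[1]/(1%N%:Z) -PoszD subnK.
Qed.

Lemma bodd_ann x : x \in glat B ->
  upow pi (2 * n).+2%:Z *: x \in scale_omod pi (2 * n.+1)%N%:Z Bd.
Proof. by move=> xB; rewrite mulnSr addn2 in_scale_omod glat_sub_dual. Qed.

Lemma bodd_int x y : x \in glat B -> y \in glat B ->
  vge 0 (upow pi (- lam) * beta x y).
Proof.
move=> xB yB; rewrite -(addNr lam).
exact: vgeM (upow_vge _ _) (dual_beta (glat_sub_dual xB) yB).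
Qed.

Lemma bodd_rad x y : x \in glat B -> y \in scale_omod pi (2 * n.+1)%N%:Z Bd ->
  vge (2 * n).+2%:Z (upow pi (- lam) * beta x y).
Proof.
rewrite mulnSr addn2; set M := Posz _ => xB; rewrite mem_scale_omod => yB.
rewrite -[y]scale1r -(upowN pi M) -scalerA betaZr mulrCA.
rewrite -[X in vge X _]addr0; apply: vgeM; first exact: upow_vge.
rewrite beta_skew mulrN; apply: vgeN; rewrite -(addNr lam).
exact: vgeM (upow_vge _ _) (dual_beta yB xB).
Qed.

(* b_{2n+1} = B / pi ^ (2(n+1)) B^* with its form pi ^ (- lam) * beta modulo
   pi ^ (2n+2) *)
Definition bodd : qdatum pi beta (2 * n).+1 :=
  QDatum bodd_sub bodd_ann bodd_int bodd_rad.

Definition pSp_bodd (g : stabilizer) : SpQ bodd :=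
  @quot_isometry _ _ _ _ _ bodd g (stab_lat g)
    (stable_scale _ (stab_dual g)).

End LatticeModules.

Section ReductionModuloU.
Variables (k : localFieldType) (W : vectType k) (pi : uniformizer k).
Variables (beta : {skew_symmetric W}) (lam : int).
Variables (B : good_lattice pi beta lam) (n : nat).
Local Notation Bd := (dual_omod beta lam (glat B)).
Local Notation bs := (bstar B).
Local Notation bo := (bodd B n).
Local Notation e := (n.+1%:Z).
Local Notation Spb := (SpQ bo).

(* the class in b_{2n+1} of pi ^ (n+1) w *)
Definition unif_class (w : W) : qmod bo := qclass bo (upow pi e *: w).

(* u^perp = pi ^ (n+1) B^* / pi ^ (2(n+1)) B^* *)
Definition uperp : set (qmod bo) :=
  [set y | exists2 b, b \in Bd & y = unif_class b]%classic.

(* For y in u^perp, the class b + B in b* of any b in B^* such that y is the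
   class of pi ^ (n+1) b: this identifies u^perp / u with b*. *)
Definition udiv (y : qmod bo) : qmod bs :=
  qclass bs (upow pi (- e) *: qrepr y).

Lemma upowNC i : upow pi (- i) * upow pi i = 1.
Proof. by rewrite mulrC upowN. Qed.

Lemma unif_dual_lat b : b \in Bd -> upow pi e *: b \in glat B.
Proof.
move=> bB; apply: glat_dual_sub; rewrite mem_scale_omod scalerA -upowD.
apply: (@omod_scale _ _ Bd (@Integer k (upow pi (-1 + e)) _)) => //.
by apply: vge_le (upow_vge pi _); rewrite addrC subr_ge0.
Qed.

Lemma dbl_e : (2 * n.+1)%N%:Z = e + e.
Proof. by rewrite -PoszD addnn mul2n. Qed.

Lemma unif_class_eq b w : b \in Bd -> w \in glat B ->
  (qclass bo w == unif_class b) = (upow pi (- e) *: w - b \in scale_omod pi e Bd).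
Proof.
move=> bB wB; rewrite qclass_eq //; last exact: unif_dual_lat.
rewrite -/bo /= !mem_scale_omod dbl_e opprD upowD !scalerBr -!scalerA.
by rewrite [upow pi (- e) *: (upow pi e *: b)]scalerA upowNC scale1r.
Qed.

Lemma unif_dual_sub : {subset scale_omod pi e Bd <= B}.
Proof.
move=> x; rewrite mem_scale_omod => xB.
by have := unif_dual_lat xB; rewrite scalerA upowN scale1r.
Qed.

Lemma uperp_repr y : uperp y -> upow pi (- e) *: qrepr y \in Bd.
Proof.
move=> [b bB yE]; have := qreprK y; rewrite [X in _ = X]yE => /eqP.
rewrite unif_class_eq ?(qrepr_num y) // => /unif_dual_sub/glat_sub_dual dB.
by rewrite -[_ *: _](subrK b) rpredD.
Qed.

Lemma udivE b : b \in Bd -> udiv (unif_class b) = qclass bs b.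
Proof.
move=> bB; have bU : uperp (unif_class b) by exists b.
apply/eqP; rewrite qclass_eq ?uperp_repr //; apply: unif_dual_sub.
by rewrite -unif_class_eq ?(qrepr_num (unif_class b)) // qreprK.
Qed.

Lemma uperp_orth y : uperp y <->
  forall z, qform y (Oclass _ (upow pi e) *: z) = 0.
Proof.
have e0 : vge 0 (upow pi e) by exact: vge_le (upow_vge pi e).
have key z : z \in glat B ->
    (qform y (Oclass _ (upow pi e) *: qclass bo z) == 0) =
    vge lam (beta (upow pi (- e) *: qrepr y) z).
  move=> zB; have yB : qrepr y \in glat B by exact: (qrepr_num y).
  rewrite scale_qclass //.
  rewrite -[y in LHS]qreprK qformE ?qnumZ //.
  have -> : (0 : Oquot k (2 * n).+1) = Oclass _ (0 : k).
    by apply: (addrI (Oclass _ (0 : k))); rewrite -OclassD ?vge0 // !addr0.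
  rewrite Oclass_eq ?vge0 ?subr0 //; last first.
    by apply: (@qform_int _ _ _ _ _ bo) => //; apply: qnumZ.
  rewrite betaZr betaZl /=; apply/idP/idP => H.
    have := vgeM (upow_vge pi (lam - e - e)) H.
    rewrite -[(2 * n).+2]addn2 -mulnSr dbl_e !mulrA -!upowD.
    by congr vge; [|congr (upow _ _ * _)]; lia.
  have := vgeM (upow_vge pi (e + e - lam)) H.
  rewrite -[(2 * n).+2]addn2 -mulnSr dbl_e !mulrA -!upowD.
  by congr vge; [|congr (upow _ _ * _)]; lia.
split=> [yU z|yO].
  apply/eqP; rewrite -[z]qreprK key; last exact: (qrepr_num z).
  by apply: dual_beta; [exact: uperp_repr|exact: (qrepr_num z)].
exists (upow pi (- e) *: qrepr y).
  by apply/dual_omodP => b bB; rewrite -key // yO.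
by rewrite /unif_class scalerA upowN scale1r qreprK.
Qed.

Lemma uperp_stable (g : Spb) y : uperp y -> uperp (g y).
Proof.
move=> /uperp_orth yO; apply/uperp_orth => z.
by rewrite -[z](sp_invK g) -linearZ sp_form yO.
Qed.

Definition ru_fun (g : Spb) (x : qmod bs) : qmod bs :=
  udiv (g (unif_class (qrepr x))).

Lemma unif_class_comb (a : k) b c : vge 0 a -> b \in Bd -> c \in Bd ->
  Oclass _ a *: unif_class b + unif_class c = unif_class (a *: b + c).
Proof.
move=> a0 bB cB; have [ub uc] := (unif_dual_lat bB, unif_dual_lat cB).
rewrite scale_qclass //.
rewrite -qclassD //; last exact: (@qnumZ _ _ _ _ _ bo).
by rewrite /unif_class scalerDr !scalerA mulrC.
Qed.

Lemma dualZ (a : k) b : vge 0 a -> b \in Bd -> a *: b \in Bd.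
Proof. exact: (@qnumZ _ _ _ _ _ bs). Qed.

Lemma ru_spec (g : Spb) b : b \in Bd -> exists c, [/\ c \in Bd,
  g (unif_class b) = unif_class c & ru_fun g (qclass bs b) = qclass bs c].
Proof.
move=> bB; set b' := qrepr (qclass bs b).
have b'B : b' \in Bd by exact: (qrepr_num (qclass bs b)).
have bU : uperp (unif_class b) by exists b.
have [c cB gE] := uperp_stable g bU.
exists c; split=> //; rewrite /ru_fun -/b'.
have dB : b' - b \in glat B by exact: (@qrepr_class _ _ _ _ _ bs).
have e0 : vge 0 (upow pi e) by exact: vge_le (upow_vge pi e).
have -> : unif_class b' =
    Oclass _ (upow pi e) *: qclass bo (b' - b) + unif_class b.
  rewrite scale_qclass //.
  have dB' := glat_sub_dual dB.
  rewrite -qclassD; [|exact: unif_dual_lat dB'|exact: unif_dual_lat bB].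
  by rewrite -scalerDr subrK.
rewrite (sp_linear g) gE /=; set d := sp_fun g _.
have dE : Oclass _ (upow pi e) *: d = unif_class (qrepr d).
  rewrite -[d in LHS]qreprK; rewrite /unif_class.
  by rewrite scale_qclass ?qrepr_num.
have rB : qrepr d \in glat B by exact: (qrepr_num d).
have -> : Oclass (2 * n).+1 (upow pi e) *: d + unif_class c =
          unif_class (qrepr d + c).
  rewrite dE /unif_class scalerDr [RHS]qclassD //; last exact: unif_dual_lat.
  exact: unif_dual_lat (glat_sub_dual rB).
have rB' := glat_sub_dual rB.
rewrite udivE ?rpredD //; apply/eqP.
by rewrite qclass_eq //; [rewrite addrK|exact: rpredD].
Qed.

Lemma ru_linear (g : Spb) : linear (ru_fun g).
Proof.
move=> a x y; rewrite -[x]qreprK -[y]qreprK -[a]OreprK.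
set u := qrepr x; set v := qrepr y; set s := Orepr a.
have uB : u \in Bd by exact: (qrepr_num x).
have vB : v \in Bd by exact: (qrepr_num y).
have s0 : vge 0 s by exact: Orepr_int.
have ZE w w' : w \in Bd -> w' \in Bd ->
    Oclass 0 s *: qclass bs w + qclass bs w' = qclass bs (s *: w + w').
  move=> wB w'B.
  rewrite scale_qclass //.
  by rewrite -qclassD // dualZ.
have [c [cB gc ->]] := ru_spec g uB; have [d [dB gd ->]] := ru_spec g vB.
rewrite ZE // ZE //.
have [|f [fB gf ->]] := ru_spec g (_ : s *: u + v \in Bd).
  by rewrite rpredD ?dualZ.
rewrite -!udivE ?rpredD ?dualZ //; congr udiv.
by rewrite -gf -!unif_class_comb // (sp_linear g) gc gd.
Qed.

Lemma ru_funK (g h : Spb) : cancel g h -> cancel (ru_fun g) (ru_fun h).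
Proof.
move=> gK x; rewrite -[x]qreprK; set b := qrepr x.
have bB : b \in Bd by exact: (qrepr_num x).
have [c [cB gc ->]] := ru_spec g bB; have [d [dB gd ->]] := ru_spec h cB.
by rewrite -!udivE // -gd -gc gK.
Qed.

Lemma ru_form (g : Spb) x y : qform (ru_fun g x) (ru_fun g y) = qform x y.
Proof.
rewrite -[x]qreprK -[y]qreprK; set b := qrepr x; set b' := qrepr y.
have bB : b \in Bd by exact: (qrepr_num x).
have b'B : b' \in Bd by exact: (qrepr_num y).
have [c [cB gc ->]] := ru_spec g bB; have [c' [c'B gc' ->]] := ru_spec g b'B.
have := sp_form g (unif_class b) (unif_class b'); rewrite gc gc'.
have uB v : v \in Bd -> upow pi e *: v \in qnum bo by exact: unif_dual_lat.
rewrite !qformE ?uB // => /eqP.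
rewrite Oclass_eq; try by apply: (@qform_int _ _ _ _ _ bo); apply: uB.
move=> H; apply/eqP; rewrite Oclass_eq; try exact: (@qform_int _ _ _ _ _ bs).
move: H; rewrite /= !betaZl !betaZr -!mulrBr !mulrA -!upowD => H.
have := vgeM (upow_vge pi (1 - e - e)) H.
rewrite -[(2 * n).+2]addn2 -mulnSr dbl_e !mulrA -!upowD.
by congr vge; [|congr (upow _ _ * _)]; lia.
Qed.

(* the morphism r_u from Sp(b_{2n+1}) to Sp(u^perp / u) = Sp(b* ) *)
Definition ru (g : Spb) : SpQ bs :=
  SpGroup (ru_linear g) (ru_funK (sp_funK g : cancel g g^-1%g))
    (ru_funK (sp_invK g : cancel g^-1%g g)) (ru_form g).

End ReductionModuloU.

Section Models.
Variables (R : realType) (k : localFieldType) (pi : uniformizer k).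
Variables (psi : k -> R[i]) (lam : int).
Variables (W : vectType k) (beta : {skew_symmetric W}).
Variables (B : good_lattice pi beta lam) (n : nat).
Local Notation Bd := (dual_omod beta lam (glat B)).
Local Notation bs := (bstar B).
Local Notation bo := (bodd B n).
Local Notation Spbs := (SpQ bs).
Local Notation Spbo := (SpQ bo).
Local Open Scope classical_set_scope.

(* the character t mod pi ^ (m+1) |-> psi (pi ^ (lam - (m+1)) t) of O_m *)
Definition char_mod (m : nat) (t : Oquot k m) : R[i] :=
  psi (upow pi (lam - m.+1%:Z) * Orepr t).

Variable V : lmodType R[i].
Variable rho : heisenberg bs -> {linear V -> V}.
Variable S : Spbs -> {linear V -> V}.

Record schrodinger_representation : Prop := {
  schrodinger_rep : is_representation rho;
  schrodinger_irr : irreducible_representation rho;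
  schrodinger_central : forall (t : residue_field k) v,
    rho (0, t) v = char_mod t *: v
}.

Record weil_representation : Prop := {
  weil_rep : is_representation S;
  weil_conj : forall (g : Spbs) (w : qmod bs) (t : residue_field k) v,
    S g (rho (w, t) (S g^-1%g v)) = rho (g w, t) v
}.

(* the domain pi ^ (- (n+1)) B of the functions in H^B_n; it contains B^* *)
Definition fdom := scale_omod pi (- n.+1%:Z) B.

Lemma dual_fdom : {subset Bd <= fdom}.
Proof.
by move=> b bB; rewrite mem_scale_omod opprK; apply: unif_dual_lat.
Qed.

Definition rho_tilde (b : W) : {linear V -> V} := rho (qclass bs b, 0).

Definition HBn : set (omod_elt fdom -> V) :=
  [set f | forall b w : omod_elt fdom, \val b \in Bd ->
     f (b + w) = psi (2^-1 * beta (\val w) (\val b)) *: rho_tilde (\val b) (f w)].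

Lemma fdom_stable (g : stabilizer B) w :
  w \in fdom -> (stab_elt g)^-1%g w \in fdom.
Proof.
by move=> wB; have -> := stable_inv (stable_scale pi _ (stab_lat g)) w.
Qed.

Definition stab_actV (g : stabilizer B) (w : omod_elt fdom) : omod_elt fdom :=
  OElt (fdom_stable g (valP w)).

Definition SBn (g : stabilizer B) (f : omod_elt fdom -> V) : omod_elt fdom -> V :=
  fun w => S (pSp_bstar g) (f (stab_actV g w)).

Definition sigma (g : Spbo) : {linear V -> V} := S (ru g).

Definition rho_uperp (y : qmod bo) : {linear V -> V} := rho (udiv y, 0).

Definition Hn : set (qmod bo -> V) :=
  [set f | forall x y : qmod bo, uperp y ->
     f (x + y) = char_mod (Ohalf k _ * qform x y) *: rho_uperp y (f x)].

Definition Su (g : Spbo) (f : qmod bo -> V) : qmod bo -> V :=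
  fun x => sigma g (f (g^-1%g x)).

Lemma Su_Hn (g : Spbo) phi : weil_representation -> Hn phi -> Hn (Su g phi).
Proof.
move=> S_weil H x y yU; rewrite /Su.
have yU' := uperp_stable g^-1%g yU.
have -> : (g^-1)%g (x + y) = g^-1%g x + g^-1%g y by rewrite linearD.
rewrite H // [X in char_mod (_ * X)](sp_form g^-1%g) linearZ /=; congr (_ *: _).
rewrite /sigma /rho_uperp.
have := weil_conj S_weil (ru g) (udiv (sp_inv g y)) 0 (S (ru g) (phi (sp_inv g x))).
rewrite -(repM (weil_rep S_weil)) mulVg (rep1 (weil_rep S_weil)) => ->.
congr (rho (_, 0) _).
have [b bB E] := yU'; rewrite /= in E; rewrite E udivE //.
have [c [cB gc]] := ru_spec g bB; rewrite /= => ->.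
by rewrite -(udivE n cB) -gc -E sp_invK.
Qed.

Lemma SBn_HBn (g : stabilizer B) f : weil_representation -> HBn f -> HBn (SBn g f).
Proof.
move=> S_weil H b w bB; rewrite /SBn.
have -> : stab_actV g (b + w) = stab_actV g b + stab_actV g w.
  apply: val_inj; rewrite /= -[sp_inv g]/((sp_opp g) : W -> W).
  exact: (linearD (sp_opp g : W -> W)).
have bB' : \val (stab_actV g b) \in dual_omod beta lam B.
  by have -> := stable_inv (stab_dual g) (\val b).
rewrite H // linearZ /= (sp_form (sp_opp g)); congr (_ *: _).
have := weil_conj S_weil (pSp_bstar g) (qclass _ (sp_inv g (\val b))) 0
  (S (pSp_bstar g) (f (stab_actV g w))).
rewrite -(repM (weil_rep S_weil)) mulVg (rep1 (weil_rep S_weil)) => ->.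
congr (rho (_, 0) _); rewrite /= quot_funE ?sp_invK //.
- exact: stab_dual.
- exact: stab_lat.
Qed.

Definition phiB (f : qmod bo -> V) : omod_elt fdom -> V :=
  fun x => f (unif_class B n (\val x)).

Definition suppB (f : omod_elt fdom -> V) : set W :=
  [set w | exists2 x : omod_elt fdom, \val x = w & f x != 0].

Definition supp (f : qmod bo -> V) : set (qmod bo) := [set x | f x != 0].

Definition stab_orbit (x : W) : set W := [set w | exists g : stabilizer B, w = g x].

(* K_B x + B^*; supports of elements of H^B_n are stable under translation by
   B^*, whereas K_B x is B^*-stable only when x is not in B^*. *)
Definition stab_orbit_mod (x : W) : set W :=
  [set w | exists2 b, b \in Bd & stab_orbit x (w - b)].

Definition Sp_orbit_mod (y : qmod bo) : set (qmod bo) :=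
  [set z | exists (g : Spbo) (y' : qmod bo), uperp y' /\ z = g y + y'].

End Models.

Arguments HBn {R k pi} psi {lam W beta} B n {V} rho _.
Arguments Hn {R k pi} psi {lam W beta} B n {V} rho _.
Arguments phiB {R k pi lam W beta} B n {V} f _.

(* Main.v *)
Require Import Defs.
From HB Require Import structures.
From mathcomp Require Import all_boot all_order all_algebra.
From mathcomp Require Import sesquilinear complex zify ring.
From mathcomp Require Import all_classical all_reals topology normedtype.

Set Implicit Arguments.
Unset Strict Implicit.
Unset Printing Implicit Defensive.

Import Order.TTheory GRing.Theory Num.Theory.

Local Open Scope ring_scope.
Local Open Scope classical_set_scope.

(* Parts (i) and (ii) are direct computations: the functions of H^B_n are
   invariant under translation by pi^(n+1) B^*, hence factor through b_{2n+1},
   and psi_{2n+1} is psi after rescaling.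

   For (iii), lifting isometries of b_{2n+1} to K_B is avoided.  In the chain
   ... > pi^j B^* >= pi^j B >= pi^(j+1) B^* > ... the group K_B is transitive on
   each successive difference, by at most two transvections; this needs
   B^** = B on the differences pi^j B^* \ pi^j B.  The position of x outside B^*
   in the chain is visible on the class of pi^(n+1) x in b_{2n+1} through its
   divisibility and that of its pairings, and these are invariant under
   Sp(b_{2n+1}) and unaffected by u^perp. *)

(** * Valuation estimates in the local field *)

Section Valuation.
Variable k : localFieldType.
Implicit Types (x y : k) (m j : int).

Lemma vgeP m x : reflect (x = 0 \/ m <= lval x) (vge m x).
Proof. by apply: (iffP orP) => -[/eqP|]; auto. Qed.

Lemma vgePn m x : reflect (x != 0 /\ lval x < m) (~~ vge m x).
Proof. by rewrite /vge negb_or -ltNge; exact: andP. Qed.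

Lemma lvalV x : x != 0 -> lval x^-1 = - lval x.
Proof.
move=> x0; have := lvalM _ _ x0 (invr_neq0 x0); rewrite divff // lval1.
by move=> /esym/eqP; rewrite addrC addr_eq0 => /eqP.
Qed.

(** Valuations are integers, so failing [vge j y] means [lval y <= j - 1]; this gives the extra
    [+ 1]. *)
Lemma vge_div m j x y : vge m x -> ~~ vge j y -> vge (m - j + 1) (x / y).
Proof.
move=> mx /vgePn[y0 yj]; apply: (@vge_le _ (m + - lval y)); first lia.
by apply: vgeM => //; rewrite /vge lvalV ?lexx ?orbT.
Qed.

Lemma vge_upow (pi : uniformizer k) m j x :
  vge (m + j) (upow pi m * x) = vge j x.
Proof.
apply/idP/idP => [H|]; last exact: vgeM (upow_vge _ _).
have := vgeM (upow_vge pi (- m)) H.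
by rewrite mulrA -upowD !addNr upow0 mul1r addrA addNr add0r.
Qed.

(** If 2 had positive valuation it would vanish in the residue field; hence 2 is a unit of the
    valuation ring. *)
Lemma vge_half : (2%N \notin [pchar (residue_field k)]) -> vge 0 (2^-1 : k).
Proof.
have two0 : vge 0 (2 : k) by apply: vgeD; exact: vge01.
move=> h2; have n2 : ~~ vge 1 (2 : k).
  apply: contra h2; rewrite !inE /= => h2.
  have -> : (2%:R : residue_field k) = Oclass 0 (2 : k).
    by rewrite OclassD ?vge01 // Oclass1 -mulr2n.
  have -> : (0 : residue_field k) = Oclass 0 (0 : k).
    by apply: (addrI (Oclass _ (0 : k))); rewrite -OclassD ?vge0 // !addr0.
  by rewrite Oclass_eq ?vge0 // subr0.
by have := vge_div (vge01 k) n2; rewrite mul1r.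
Qed.

End Valuation.

(** * Coordinates on lattices and separation by linear forms *)

Section Lattices.
Variables (k : localFieldType) (W : vectType k).
Implicit Types (A : omod W) (v w : W).
Local Notation e i := (coord (vbasis {:W}) i).

Lemma omodZ A (a : k) v : vge 0 a -> v \in A -> a *: v \in A.
Proof. by move=> a0; apply: (@omod_scale _ _ A (Integer a0)). Qed.

Lemma vboxD m v w : vbox m v -> vbox m w -> vbox m (v + w).
Proof. by move=> mv mw i; rewrite linearD; apply: vgeD; [exact: mv|exact: mw]. Qed.

Lemma vbox_exists v : exists m : nat, vbox (- m%:Z) v.
Proof.
have H (s : seq 'I_(\dim {:W})) : exists m : nat, forall i, i \in s -> vge (- m%:Z) (e i v).
  elim: s => [|i s [m IH]]; first by exists 0%N.
  exists (maxn m `|lval (e i v)|%N) => j; rewrite inE => /orP[/eqP ->|/IH].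
    (* The bound also covers a zero coordinate, whatever value [lval] takes at 0. *)
    by apply/vgeP; right; lia.
  by apply: vge_le; lia.
by have [m mH] := H (enum 'I_(\dim {:W})); exists m => i; apply: mH; rewrite mem_enum.
Qed.

Lemma vtop_openE (A : set (vtop W)) : open A = vopen A.
Proof. by []. Qed.

(** The boxes [vbox (- m)] are open, increase with [m] and cover [W], so one of them contains the
    compact set. *)
Lemma compact_bounded A : compact ([set` A] : set (vtop W)) ->
  exists m : int, forall v, v \in A -> vbox m v.
Proof.
move=> /compact_near_coveringP/(_ nat \oo (fun m v => vbox (- m%:Z) v)).
case=> [v _|m _ mA]; last by exists (- m%:Z) => v; apply: (mA m (leqnn m)).
have [m mv] := vbox_exists v.
exists (vbox (- m%:Z), [set j | (m <= j)%N]) => /= [|[w j] /= [mw mj] i]; last first.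
  by apply: vge_le (mw i); lia.
split; last by exists m.
apply: (@open_nbhs_nbhs (vtop W)); split=> //; rewrite vtop_openE => w mw.
by exists (- m%:Z) => y my; apply: vboxD.
Qed.

Lemma open_absorbing A v : open ([set` A] : set (vtop W)) ->
  exists m : int, forall a : k, vge m a -> a *: v \in A.
Proof.
rewrite vtop_openE => /(_ 0 _)[|m mA]; first by rewrite /= rpred0.
have [j jv] := vbox_exists v; exists (m + j%:Z) => a ma.
rewrite -[_ *: _]add0r; apply: mA => i; rewrite linearZ /=.
by rewrite -[m](addrK j%:Z); apply: vgeM.
Qed.

(* Elimination of the last coordinate: among the elements of [A] supported on
   the first coordinates, one whose last coordinate has minimal valuation
   clears that coordinate in all the others. *)
Lemma lattice_separation A v : open ([set` A] : set (vtop W)) ->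
  compact ([set` A] : set (vtop W)) -> v \notin A ->
  exists f : W -> k^o, [/\ linear f, forall w, w \in A -> vge 0 (f w) & ~~ vge 0 (f v)].
Proof.
move=> Ao /compact_bounded[m mA] vA.
pose U j w := forall i : 'I_(\dim {:W}), (j <= i)%N -> e i w = 0.
suff H j : (j <= \dim {:W})%N -> forall v, U j v -> v \notin A ->
    exists f : W -> k^o, [/\ linear f,
      forall w, U j w -> w \in A -> vge 0 (f w) & ~~ vge 0 (f v)].
  have UT w : U (\dim {:W}) w by move=> i; rewrite leqNgt ltn_ord.
  have [f [fl fA fv]] := H _ (leqnn _) v (UT v) vA.
  by exists f; split=> // w; apply: fA.
elim: j {v vA} => [_|j IH jd] v Uv vA.
  have v0 : v = 0.
    rewrite (coord_vbasis (memvf v)); apply: big1 => i _.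
    by rewrite Uv // scale0r.
  by rewrite v0 rpred0 in vA.
pose i0 := Ordinal jd.
(* The shift by the lower bound [m] turns valuations into naturals, so that a minimum exists. *)
pose P s := `[< exists w, [/\ w \in A, U j.+1 w, e i0 w != 0 &
                              lval (e i0 w) = m + s%:Z] >].
have PE w : w \in A -> U j.+1 w -> e i0 w != 0 -> exists2 s, P s & lval (e i0 w) = m + s%:Z.
  move=> wA wU w0; have /vgeP[/eqP|ge] := mA w wA i0; first by rewrite (negbTE w0).
  exists `|lval (e i0 w) - m|%N; last by lia.
  by apply/asboolP; exists w; split => //; lia.
(* Openness of [A] provides a multiple of the basis vector of index [i0] in [A] with nonzero
   coordinate. *)
have [s0 s0P] : exists s, P s.
  pose bi := (vbasis {:W})`_i0.
  have biE i : e i bi = (i == i0)%:R.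
    by rewrite coord_free ?(basis_free (vbasisP _)) //= eq_sym.
  have [t tA] := open_absorbing bi Ao.
  have [pi pi0 pi1] := @lval_onto k.
  have piA : upow (Uniformizer pi0 pi1) t *: bi \in A by apply/tA/upow_vge.
  have [||s sP _] := PE _ piA; last by exists s.
    by move=> i ji; rewrite linearZ /= biE -val_eqE /= (gtn_eqF ji) mulr0.
  by rewrite linearZ /= biE eqxx mulr1 /upow expfz_neq0.
case: (ex_minnP (ex_intro _ s0 s0P)) => s /asboolP[b [bA bU b0 bs]] smin.
set c := e i0 b in b0 bs.
have divc w : w \in A -> U j.+1 w -> vge 0 (e i0 w / c).
  move=> wA wU; have [->|w0] := eqVneq (e i0 w) 0; first by rewrite mul0r vge0.
  have [s' /smin ss' ws'] := PE w wA wU w0.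
  by apply/vgeP; right; rewrite lvalM ?invr_neq0 // lvalV //; lia.
(* If the coordinate of [v] is not an integral multiple of [c], the coordinate divided by [c]
   already separates. Otherwise [b] clears it and the induction hypothesis applies to the
   remainder. *)
have [vc|vc] := boolP (vge 0 (e i0 v / c)); last first.
  exists (fun w => e i0 w / c); split=> // [a x y|w wU wA]; last exact: divc.
  by rewrite linearP /= mulrDl -mulrA.
have redU w : U j.+1 w -> U j (w - (e i0 w / c) *: b).
  move=> wU i; rewrite leq_eqVlt linearB linearZ /= => /orP[ji|ji].
    have -> : i = i0 by apply/val_inj/esym/eqP.
    by rewrite mulfVK // subrr.
  by rewrite wU // bU // mulr0 subrr.
have := IH (ltnW jd) _ (redU v Uv) _; case=> [|f [fl fA fv]].
  by apply: contra vA => H; rewrite -[v](subrK ((e i0 v / c) *: b)) rpredD // omodZ.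
exists (fun w => f (w - (e i0 w / c) *: b)); split=> // [a x y|w wU wA].
  rewrite -fl; congr f; rewrite linearP /= mulrDl -mulrA scalerDl -scalerA.
  by rewrite scalerBr opprD addrACA.
by apply: fA; [exact: redU|rewrite rpredB // omodZ // divc].
Qed.

(** * Duality for the symplectic form: B^** = B *)

Variables (pi : uniformizer k) (beta : {skew_symmetric W}).
Hypothesis beta_sympl : is_psymplectic beta.

(** Nondegeneracy makes the map from [c] to its pairings with the basis injective; equal dimensions
    make it surjective. *)
Lemma beta_represents (f : W -> k^o) : linear f ->
  exists c, forall w, beta w c = f w.
Proof.
move=> fl; pose F := GRing.isLinear.Build k W k^o _ f fl.
pose fL : {linear W -> k^o} := HB.pack f F.
pose h (c : W) : 'rV[k]_(\dim {:W}) := \row_i beta (vbasis {:W})`_i c.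
have hl : linear h.
  by move=> a x y; apply/rowP => i; rewrite !mxE linearP.
pose hL : {linear W -> 'rV[k]_(\dim {:W})} := HB.pack h (GRing.isLinear.Build _ _ _ _ h hl).
pose H := linfun hL.
have betaE c w : beta w c = \sum_i e i w * h c 0 i.
  rewrite {1}(coord_vbasis (memvf w)) linear_sumlz; apply: eq_bigr => i _.
  by rewrite linearZl_LR mxE.
have ker0 : lker H == 0%VS.
  apply/lker0P => c d; rewrite !lfunE /= => cd.
  have [nd _ _] := beta_sympl; apply/eqP; rewrite -subr_eq0 -memv0.
  rewrite -(eqP nd); apply/mem_orthovP => w _.
  have E : beta w (c - d) = 0 by rewrite betaBr !betaE cd subrr.
  by rewrite beta_skew E oppr0.
have full : limg H = fullv.
  apply/eqP; rewrite eqEdim subvf dimvf /dim /= mul1n.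
  have := limg_ker_dim H fullv; rewrite (eqP ker0) capv0 dimv0 add0n => ->.
  by rewrite dimvf.
have /memv_imgP[c _ cE] : (\row_i f (vbasis {:W})`_i) \in limg H.
  by rewrite full memvf.
exists c => w; rewrite betaE -[f w]/(fL w) [in RHS](coord_vbasis (memvf w)).
rewrite linear_sum; apply: eq_bigr => i _; rewrite linearZ /=.
by rewrite lfunE /= in cE; rewrite -cE mxE.
Qed.

Variable lam : int.

(** This is the nontrivial inclusion of B^** = B: a separating form, rescaled by [pi ^ lam], is
    pairing with a vector of [B^*]. *)
Lemma dual_separates (B : good_lattice pi beta lam) v : v \notin glat B ->
  exists2 c, c \in dual_omod beta lam B & ~~ vge lam (beta v c).
Proof.
move=> vB; have [f [fl fB fv]] := lattice_separation (@glat_open _ _ _ _ _ B)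
  (@glat_compact _ _ _ _ _ B) vB.
have [|c cE] := @beta_represents (fun w => upow pi lam * f w).
  by move=> a x y; rewrite fl mulrDr; congr (_ + _); apply: mulrCA.
exists c; last by rewrite cE -[lam in vge lam]addr0 vge_upow.
apply/dual_omodP => b bB; rewrite beta_skew; apply: vgeN; rewrite cE.
by rewrite -[lam in vge lam]addr0 vge_upow fB.
Qed.

End Lattices.

(** * Orbits of K_B on W by transvections *)

Section StabilizerOrbits.
Variables (k : localFieldType) (W : vectType k) (pi : uniformizer k).
Variables (beta : {skew_symmetric W}) (lam : int).
Hypotheses (char0 : [pchar k] =i pred0) (beta_sympl : is_psymplectic beta).
Variable B : good_lattice pi beta lam.
Local Notation Bd := (dual_omod beta lam (glat B)).
Implicit Types x y c d v : W.

Lemma betaDl x y z : beta (x + y) z = beta x z + beta y z.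
Proof. by rewrite linearDl. Qed.

Lemma betaDr x y z : beta x (y + z) = beta x y + beta x z.
Proof. by rewrite linearD. Qed.

Lemma beta_alt v : beta v v = 0.
Proof.
apply/eqP; have /eqP := beta_skew beta v v.
rewrite -addr_eq0 -mulr2n -mulr_natr mulf_eq0 => /orP[//|/eqP two0].
by have := char0 2; rewrite !inE two0 eqxx.
Qed.

Lemma stable_stabilizer (g : spgroup beta) : stable (glat B) g ->
  exists h : stabilizer B, stab_elt h = g.
Proof.
move=> gB; have gE : [set g v | v in [set` glat B]] = [set` glat B].
  apply/seteqP; split=> [_ [v vB <-]|v vB] /=; first by rewrite gB.
  by exists (sp_inv g v); rewrite /= ?sp_invK // -gB sp_invK.
by exists (exist _ g gE).
Qed.

Lemma stab_orbit_refl x : stab_orbit B x x.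
Proof.
have [|h hE] := @stable_stabilizer 1%g; first by move=> v.
by exists h; rewrite hE.
Qed.

Lemma stab_orbit_trans x y z :
  stab_orbit B x y -> stab_orbit B y z -> stab_orbit B x z.
Proof.
move=> [g ->] [h ->]; have [|l lE] := @stable_stabilizer (stab_elt h * stab_elt g)%g.
  by move=> v; rewrite /= !stab_lat.
by exists l; rewrite lE.
Qed.

Lemma stab_orbitZ a x y : stab_orbit B x y -> stab_orbit B (a *: x) (a *: y).
Proof. by move=> [g ->]; exists g; rewrite linearZ. Qed.

Definition transvection_fun (a : k) d v := v + (a * beta v d) *: d.

Lemma transvection_linear a d : linear (transvection_fun a d).
Proof.
move=> b u v; rewrite /transvection_fun betaDl betaZl mulrDr scalerDl mulrCA.
by rewrite scalerDr scalerA addrACA.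
Qed.

Lemma transvection_funK a d :
  cancel (transvection_fun a d) (transvection_fun (- a) d).
Proof.
move=> v; rewrite /transvection_fun betaDl betaZl beta_alt mulr0 addr0.
by rewrite mulNr scaleNr addrK.
Qed.

Lemma transvection_form a d u v :
  beta (transvection_fun a d u) (transvection_fun a d v) = beta u v.
Proof.
rewrite /transvection_fun betaDl !betaDr !betaZl !betaZr beta_alt.
by rewrite (beta_skew beta d v); ring.
Qed.

Definition transvection a d : spgroup beta :=
  SpGroup (transvection_linear a d) (transvection_funK a d)
    (fun v => etrans (congr1 (fun b => transvection_fun b d _) (esym (opprK a)))
                     (transvection_funK (- a) d v))
    (transvection_form a d).

(** The transvection along [y - x] with parameter [1 / beta x y] sends [x] to [y], because
    [beta x (y - x) = beta x y]. *)
Lemma transvection_orbit x y : beta x y != 0 ->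
  (forall v, v \in glat B -> (beta v (y - x) / beta x y) *: (y - x) \in glat B) ->
  stab_orbit B x y.
Proof.
move=> xy0 xyB; have xE : beta x (y - x) = beta x y.
  by rewrite betaBr beta_alt subr0.
have [|h hE] := @stable_stabilizer (transvection (beta x y)^-1 (y - x)); last first.
  by exists h; rewrite hE /= /transvection_fun xE mulVf // scale1r addrC subrK.
move=> v; rewrite /= /transvection_fun mulrC.
(* A vector and its image have the same pairing with [y - x], so the correction term can be computed
   from the image and subtracted. *)
apply/idP/idP => [H|vB]; last by rewrite rpredD // xyB.
have := xyB _ H; rewrite betaDl betaZl beta_alt mulr0 addr0 => H'.
by rewrite -[v](addrK ((beta v (y - x) / beta x y) *: (y - x))) rpredB.
Qed.

(** Here [beta x y] has valuation at most [lam] while [beta v (y - x)] has at least [lam]: the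
    coefficient is integral. *)
Lemma lattice_orbit1 x y : x \in glat B -> y \in glat B ->
  ~~ vge (lam + 1) (beta x y) -> stab_orbit B x y.
Proof.
move=> xB yB xy; have [xy0 _] := vgePn _ _ xy.
apply: transvection_orbit => // v vB; have dB : y - x \in glat B by rewrite rpredB.
apply: omodZ => //; have := vge_div (dual_beta (glat_sub_dual vB) dB) xy.
by apply: vge_le; lia.
Qed.

(** Now [y - x] is only in [B^*], but the coefficient is divisible by [pi], and [pi B^*] lies in
    [B]. *)
Lemma dual_orbit1 x y : x \in Bd -> y \in Bd ->
  ~~ vge lam (beta x y) -> stab_orbit B x y.
Proof.
move=> xB yB xy; have [xy0 _] := vgePn _ _ xy.
apply: transvection_orbit => // v vB; have dB : y - x \in Bd by rewrite rpredB.
have H : vge lam (beta v (y - x)).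
  by rewrite beta_skew; exact: vgeN (dual_beta dB vB).
have {}H := vge_div H xy; set a := _ / _ in H *.
rewrite -[a]mul1r -(upowN pi 1) -mulrA mulrC -scalerA.
apply: omodZ; last exact: unif_dual.
by rewrite -(vge_upow pi 1) mulrA upowN mul1r; apply: vge_le H; lia.
Qed.

(* Two steps through a vector [c] pairing well with both [x] and [y]; such a
   [c] exists since a group is not the union of two proper subgroups. *)
Lemma orbit_two_steps (A : omod W) j x y :
  {in A &, forall u v, ~~ vge j (beta u v) -> stab_orbit B u v} ->
  x \in A -> y \in A ->
  (exists2 c, c \in A & ~~ vge j (beta x c)) ->
  (exists2 c, c \in A & ~~ vge j (beta y c)) -> stab_orbit B x y.
Proof.
move=> A1 xA yA [c cA xc] [d dA yd].
suff [f [fA xf yf]] : exists f, [/\ f \in A, ~~ vge j (beta x f) & ~~ vge j (beta y f)].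
  apply: (stab_orbit_trans (A1 _ _ xA fA xf)); apply: A1 => //.
  by rewrite beta_skew; apply: contra yf => /vgeN; rewrite opprK.
have [yc|yc] := boolP (vge j (beta y c)); last by exists c.
have [xd|xd] := boolP (vge j (beta x d)); last by exists d.
exists (c + d); rewrite rpredD // !betaDr; split=> //.
  by apply: contra xc => H; rewrite -[beta x c](addrK (beta x d)) vgeD ?vgeN.
by apply: contra yd => H; rewrite -[beta y d](addKr (beta y c)) vgeD ?vgeN.
Qed.

(** After division by [pi ^ j], lying outside [pi B^*] means having a pairing of valuation at most
    [lam] with some vector of [B], as [orbit_two_steps] requires. *)
Lemma lattice_orbit j x y : x \in scale_omod pi j B -> y \in scale_omod pi j B ->
  x \notin scale_omod pi (j + 1) Bd -> y \notin scale_omod pi (j + 1) Bd ->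
  stab_orbit B x y.
Proof.
have E v : v = upow pi j *: (upow pi (- j) *: v) by rewrite scalerA upowN scale1r.
have pair v : v \notin scale_omod pi (j + 1) Bd ->
    exists2 c, c \in glat B & ~~ vge (lam + 1) (beta (upow pi (- j) *: v) c).
  rewrite mem_scale_omod => /dual_omodP/existsNP[c /not_implyP[cB /negP vc]].
  exists c => //; apply: contra vc; rewrite !betaZl opprD [- j - 1]addrC upowD -mulrA.
  by rewrite -(vge_upow pi (-1)) addrCA addNr addr0.
rewrite !mem_scale_omod => xB yB xn yn; rewrite (E x) (E y); apply: stab_orbitZ.
exact: (orbit_two_steps (j := lam + 1) lattice_orbit1 xB yB (pair _ xn) (pair _ yn)).
Qed.

(** The auxiliary vectors must now come from [B^*]; [dual_separates] supplies them. *)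
Lemma dual_orbit j x y : x \in scale_omod pi j Bd -> y \in scale_omod pi j Bd ->
  x \notin scale_omod pi j B -> y \notin scale_omod pi j B -> stab_orbit B x y.
Proof.
have E v : v = upow pi j *: (upow pi (- j) *: v) by rewrite scalerA upowN scale1r.
rewrite !mem_scale_omod => xB yB xn yn; rewrite (E x) (E y); apply: stab_orbitZ.
apply: (orbit_two_steps (A := Bd) (j := lam)) => //; first exact: dual_orbit1.
  exact: dual_separates.
exact: dual_separates.
Qed.

End StabilizerOrbits.

(** * Orbits and isometries under reduction to b_{2n+1} *)

Section ReductionOrbits.
Variables (k : localFieldType) (W : vectType k) (pi : uniformizer k).
Variables (beta : {skew_symmetric W}) (lam : int).
Variables (B : good_lattice pi beta lam) (n : nat).
Local Notation Bd := (dual_omod beta lam (glat B)).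
Local Notation bo := (bodd B n).
Local Notation e := (n.+1%:Z).
Local Notation Spb := (SpQ bo).
Local Notation ucl := (unif_class B n).
Implicit Types x y w b : W.

Lemma mem_fdom x : (x \in fdom B n) = (upow pi e *: x \in glat B).
Proof. by rewrite mem_scale_omod opprK. Qed.

Lemma upow_int (j : nat) : vge 0 (upow pi j%:Z).
Proof. exact: vge_le (upow_vge pi j%:Z). Qed.

Lemma scale_dual_sub (j : int) : 1 <= j -> {subset scale_omod pi j Bd <= B}.
Proof.
move=> j1 x; rewrite mem_scale_omod => xB; apply: glat_dual_sub.
apply: (@scale_omod_sub _ _ pi (j - 1)); first lia.
by rewrite !mem_scale_omod scalerA -upowD -opprD [1 + _]addrC subrK.
Qed.

Lemma unif_classD x y : x \in fdom B n -> y \in fdom B n ->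
  ucl (x + y) = ucl x + ucl y.
Proof. by rewrite !mem_fdom => xB yB; rewrite -qclassD // -scalerDr. Qed.

Lemma unif_class_surj (z : qmod bo) : exists2 x, x \in fdom B n & z = ucl x.
Proof.
exists (upow pi (- e) *: qrepr z).
  by rewrite mem_fdom scalerA upowN scale1r (qrepr_num z).
by rewrite /unif_class scalerA upowN scale1r qreprK.
Qed.

Lemma unif_class_fdom_eq x y : x \in fdom B n -> y \in fdom B n ->
  (ucl x == ucl y) = (x - y \in scale_omod pi e Bd).
Proof.
rewrite !mem_fdom => xB yB; rewrite qclass_eq //= -scalerBr !mem_scale_omod.
by rewrite scalerA -upowD dbl_e opprD subrK.
Qed.

Lemma uperp_unif_class x : x \in fdom B n -> uperp (ucl x) <-> x \in Bd.
Proof.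
move=> xB; split=> [[b bB /eqP]|xBd]; last by exists x.
have bF : b \in fdom B n by exact: dual_fdom.
rewrite unif_class_fdom_eq // => /unif_dual_sub/glat_sub_dual dB.
by rewrite -[x](subrK b) rpredD.
Qed.

(** Divisibility by [pi ^ j] can be tested modulo [pi ^ (2(n+1)) B^*], since for [j <= n] this
    lattice lies in [pi ^ j B]. *)
Lemma mem_lattice_class (j : nat) x : (j <= n)%N -> x \in fdom B n ->
  x \in scale_omod pi (j%:Z - e) B <->
  exists z, ucl x = Oclass _ (upow pi j%:Z) *: z.
Proof.
move=> jn xB; rewrite mem_scale_omod opprB; split=> [xj|[z]].
  exists (qclass bo (upow pi (e - j%:Z) *: x)); rewrite scale_qclass ?upow_int //.
  by rewrite scalerA -upowD addrC subrK.
rewrite mem_fdom in xB; have zB : qrepr z \in qnum bo by exact: (qrepr_num z).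
rewrite -[z]qreprK scale_qclass ?upow_int // => /eqP.
have zB' : upow pi j%:Z *: qrepr z \in qnum bo by exact: qnumZ (upow_int j) zB.
rewrite qclass_eq // => H.
have {}H : upow pi (- (2 * n.+1)%N%:Z) *: (upow pi e *: x - upow pi j%:Z *: qrepr z)
  \in Bd := H.
rewrite -[_ *: x](subrK (qrepr z)) rpredD // (@scale_dual_sub (e + e - j%:Z)) //; first lia.
rewrite mem_scale_omod scalerBr; move: H; rewrite scalerBr !scalerA -!upowD dbl_e.
by congr (_ *: _ - _ *: _ \in Bd); congr upow; lia.
Qed.

(** The form on b_{2n+1} is read modulo [pi ^ (2n+2)], so orthogonality to the multiples of
    [pi ^ (2n+2-j)] bounds the pairings of [pi ^ (n+1) x] with [B] to the required order. *)
Lemma mem_dual_class (j : nat) x : (j <= n.+1)%N -> x \in fdom B n ->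
  x \in scale_omod pi (j%:Z - e) Bd <->
  forall z, qform (ucl x) (Oclass _ (upow pi (2 * n.+1 - j)%N%:Z) *: z) = 0.
Proof.
move=> jn; rewrite mem_fdom mem_scale_omod opprB => xB.
have key c : c \in glat B ->
    (qform (ucl x) (Oclass _ (upow pi (2 * n.+1 - j)%N%:Z) *: qclass bo c) == 0) =
    vge lam (beta (upow pi (e - j%:Z) *: x) c).
  move=> cB; rewrite scale_qclass ?upow_int //.
  have cB' : upow pi (2 * n.+1 - j)%N%:Z *: c \in qnum bo by exact: qnumZ (upow_int _) _.
  rewrite qformE //.
  have -> : (0 : Oquot k (2 * n).+1) = Oclass _ (0 : k).
    by apply: (addrI (Oclass _ (0 : k))); rewrite -OclassD ?vge0 // !addr0.
  rewrite Oclass_eq ?vge0 ?subr0 //; last first.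
    exact: (@qform_int _ _ _ _ _ bo).
  rewrite !betaZl betaZr /= -[in RHS](vge_upow pi (e + e - lam)) !mulrA -!upowD.
  by congr (vge _ (upow _ _ * _)); lia.
split=> [/dual_omodP xd z|xO].
  have zB : qrepr z \in glat B by exact: (qrepr_num z).
  by apply/eqP; rewrite -[z]qreprK key // xd.
by apply/dual_omodP => c cB; rewrite -key // xO.
Qed.

Lemma mem_lattice_Sp (g : Spb) (j : nat) x y : (j <= n)%N ->
  x \in fdom B n -> y \in fdom B n -> ucl y = g (ucl x) ->
  (y \in scale_omod pi (j%:Z - e) B) = (x \in scale_omod pi (j%:Z - e) B).
Proof.
move=> jn xB yB yE; apply/idP/idP => /(mem_lattice_class jn)-/(_ _)[] // z zE;
  apply/mem_lattice_class => //.
  exists (sp_inv g z); apply: (can_inj (sp_funK g)).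
  by rewrite -yE zE linearZ /= sp_invK.
by exists (g z); rewrite yE zE linearZ.
Qed.

Lemma mem_dual_Sp (g : Spb) (j : nat) x y : (j <= n.+1)%N ->
  x \in fdom B n -> y \in fdom B n -> ucl y = g (ucl x) ->
  (y \in scale_omod pi (j%:Z - e) Bd) = (x \in scale_omod pi (j%:Z - e) Bd).
Proof.
move=> jn xB yB yE; apply/idP/idP => H; apply/mem_dual_class => // z.
  by rewrite -(sp_form g) -yE linearZ (iffLR (mem_dual_class jn yB) H).
rewrite yE -[z](sp_invK g) -linearZ sp_form.
exact: (iffLR (mem_dual_class jn xB) H).
Qed.

Hypotheses (char0 : [pchar k] =i pred0) (beta_sympl : is_psymplectic beta).

(** Once the [u^perp] part [b] is removed from [w], the two tests above place [x] and [w] in the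
    same layer of the chain, where K_B is transitive. *)
Lemma Sp_orbit_lift (g : Spb) (y' : qmod bo) x w :
  x \in fdom B n -> w \in fdom B n -> x \notin Bd ->
  uperp y' -> ucl w = g (ucl x) + y' -> stab_orbit B x w.
Proof.
move=> xB wB xn [b bB ->] wE.
have bF : b \in fdom B n by exact: dual_fdom.
have wbF : w - b \in fdom B n by rewrite rpredB.
have {}wE : ucl (w - b) = g (ucl x).
  by apply: (addIr (ucl b)); rewrite -unif_classD // subrK.
(* Subtracting [b] is harmless because [B^*] lies in [pi ^ (j - e) B] as soon as [j < e]. *)
have latE (j : nat) : (j <= n)%N ->
    (w \in scale_omod pi (j%:Z - e) B) = (x \in scale_omod pi (j%:Z - e) B).
  move=> jn; rewrite -(mem_lattice_Sp jn xB wbF wE) rpredBr //.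
  rewrite mem_scale_omod opprB; apply: (@scale_dual_sub (e - j%:Z)); first lia.
  by rewrite in_scale_omod.
have dualE (j : nat) : (j <= n.+1)%N ->
    (w \in scale_omod pi (j%:Z - e) Bd) = (x \in scale_omod pi (j%:Z - e) Bd).
  move=> jn; rewrite -(mem_dual_Sp jn xB wbF wE) rpredBr //.
  by rewrite mem_scale_omod opprB subzn // omodZ // upow_int.
have ex : exists j : nat, x \notin scale_omod pi (j%:Z - e) B.
  exists n.+1; rewrite mem_scale_omod subrr oppr0 scale1r.
  by apply: contra xn; apply: glat_sub_dual.
(* The least index leaving the chain is not 0, since [x] is in [fdom B n]; write it [j.+1]. *)
case: (ex_minnP ex) => -[|j] xj minj.
  by move: xj; rewrite sub0r xB.
have xj' : x \in scale_omod pi (j%:Z - e) B.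
  by apply/negPn/negP => /minj; rewrite ltnn.
have jn : (j <= n)%N.
  rewrite leqNgt; apply/negP => jn.
  have : x \notin scale_omod pi (n.+1%:Z - e) B.
    rewrite mem_scale_omod subrr oppr0 scale1r.
    by apply: contra xn; apply: glat_sub_dual.
  by move=> /minj; rewrite ltnS leqNgt jn.
have [xd|xd] := boolP (x \in scale_omod pi (j.+1%:Z - e) Bd).
  (* [latE] at [j.+1] needs [j < n]; for [j = n] the assumption [xd] would put [x] in [B^*]. *)
  have jn' : (j < n)%N.
    rewrite ltn_neqAle jn andbT; apply: contra xn => /eqP jE; move: xd.
    by rewrite jE mem_scale_omod subrr oppr0 scale1r.
  by apply: (@dual_orbit _ _ _ _ _ char0 beta_sympl B (j.+1%:Z - e)); rewrite ?dualE ?latE.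
have jE : j%:Z - e + 1 = j.+1%:Z - e by lia.
by apply: (@lattice_orbit _ _ _ _ _ char0 B (j%:Z - e)); rewrite ?jE ?dualE ?latE.
Qed.

Lemma unif_class_stab (g : stabilizer B) x : x \in fdom B n ->
  ucl (g x) = pSp_bodd n g (ucl x).
Proof.
rewrite mem_fdom => xB; rewrite /= quot_funE //.
- by rewrite /unif_class linearZ.
- exact: stab_lat.
- exact/stable_scale/stab_dual.
Qed.

Lemma ru_pSp_bodd (g : stabilizer B) : ru (pSp_bodd n g) = pSp_bstar g.
Proof.
apply: spgroup_eq => z; rewrite -[z]qreprK; set b := qrepr z.
have bB : b \in Bd by exact: (qrepr_num z).
have [c [cB gc /= ->]] := ru_spec (pSp_bodd n g) bB.
rewrite quot_funE //; [|exact: stab_dual|exact: stab_lat].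
have gB : g b \in Bd by rewrite stab_dual.
by rewrite -(udivE n cB) -gc -unif_class_stab ?dual_fdom // udivE.
Qed.

End ReductionOrbits.

(** * Comparison of the two function spaces *)

Section LatticeModel.
Variables (R : realType) (k : localFieldType) (pi : uniformizer k).
Variables (psi : k -> R[i]) (lam : int).
Hypotheses (psi_char : unitary_character psi) (psi_cond : has_conductor psi lam).
Hypothesis residue_char : 2%N \notin [pchar (residue_field k)].
Variables (W : vectType k) (beta : {skew_symmetric W}).
Variables (B : good_lattice pi beta lam) (n : nat).
Local Notation Bd := (dual_omod beta lam (glat B)).
Local Notation bo := (bodd B n).
Local Notation e := (n.+1%:Z).
Local Notation ucl := (unif_class B n).
Implicit Types x y w b : W.

(** Two representatives differ by a multiple of [pi ^ (m+1)], which after rescaling falls where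
    [psi] is trivial. *)
Lemma char_mod_Oclass (m : nat) (t : k) : vge 0 t ->
  char_mod pi psi lam (Oclass m t) = psi (upow pi (lam - m.+1%:Z) * t).
Proof.
move=> t0; have /(vgeM (upow_vge pi (lam - m.+1%:Z))) := Orepr_class m t0.
rewrite subrK => /(psi_cond.1) E.
rewrite /char_mod -[Orepr _](subrK t) mulrDr (char_add psi_char).
by rewrite E mul1r.
Qed.

Lemma char_mod_unif_class w b : w \in fdom B n -> b \in fdom B n ->
  char_mod pi psi lam (Ohalf k _ * qform (ucl w) (ucl b)) = psi (2^-1 * beta w b).
Proof.
rewrite !mem_fdom => wB bB; rewrite qformE //.
have int2 := vge_half residue_char; have intb := @qform_int _ _ _ _ _ bo _ _ wB bB.
rewrite -OclassM // char_mod_Oclass; last by rewrite -[0]addr0 vgeM.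
congr psi; rewrite mulrCA; congr (_ * _); rewrite betaZl betaZr /= !mulrA -!upowD.
by rewrite [X in upow pi X](_ : _ = 0) ?mul1r //; lia.
Qed.

Variables (V : lmodType R[i]) (rho : heisenberg (bstar B) -> {linear V -> V}).
Hypothesis rho_schrodinger : schrodinger_representation psi rho.

Lemma phiB_HBn (phi : qmod bo -> V) :
  Hn psi B n rho phi -> HBn psi B n rho (phiB B n phi).
Proof.
move=> H b w bB; have [bF wF] := (valP b, valP w).
rewrite /phiB addrC raddfD /= unif_classD // H; last by exists (\val b).
by rewrite char_mod_unif_class // /rho_uperp udivE.
Qed.

(** The difference of [x] and [y] is in [pi ^ (n+1) B^*]. It lies in [B], so [rho_tilde] is trivial
    on it, and its pairing with [y] is in the ideal of exponent [lam], so the factor [psi] is 1. *)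
Lemma HBn_unif_class (f : omod_elt (fdom B n) -> V) (x y : omod_elt (fdom B n)) :
  HBn psi B n rho f ->
  ucl (\val x) = ucl (\val y) -> f x = f y.
Proof.
move=> fH /eqP; rewrite unif_class_fdom_eq ?(valP x) ?(valP y) // => dB.
have dL : \val x - \val y \in glat B by exact: unif_dual_sub dB.
rewrite -[x](subrK y) fH /=; last exact: glat_sub_dual.
have E0 : qclass (bstar B) (\val x - \val y) = 0.
  apply: (addIr (qclass (bstar B) 0)); rewrite add0r -qclassD ?rpred0 ?addr0 //.
    apply/eqP; rewrite qclass_eq ?rpred0 ?subr0 //; exact: glat_sub_dual.
  exact: glat_sub_dual.
rewrite /rho_tilde E0 -[(0, 0)]/(1%g : heisenberg (bstar B)).
rewrite (rep1 (schrodinger_rep rho_schrodinger)).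
rewrite psi_cond.1 ?scale1r // -[lam in vge lam]add0r.
apply: vgeM (vge_half residue_char) _.
rewrite mem_scale_omod in dB; have yB := valP y; rewrite mem_fdom in yB.
have := dual_beta dB yB; rewrite betaZl betaZr mulrA upowNC mul1r.
by rewrite beta_skew => /vgeN; rewrite opprK.
Qed.

Lemma phiB_bij : set_bij (Hn psi B n rho) (HBn psi B n rho) (phiB B n).
Proof.
split=> [|phi phi' _ _ E|f fH]; first exact: phiB_HBn.
  apply/funext => z; have [x xF ->] := unif_class_surj z.
  exact: (congr1 (fun f => f (OElt xF)) E).
(* The preimage of [f] evaluates [f] on chosen representatives; by [HBn_unif_class] the choice does
   not matter. *)
pose lift (z : qmod bo) := to_omod (fdom B n) (upow pi (- e) *: qrepr z).
have liftE z : ucl (\val (lift z)) = z.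
  rewrite to_omodK; first by rewrite /unif_class scalerA upowN scale1r qreprK.
  by rewrite mem_fdom scalerA upowN scale1r (qrepr_num z).
exists (f \o lift); last first.
  by apply/funext => x; exact: (HBn_unif_class fH (liftE _)).
move=> z y [b bB yE] /=; have bF : b \in fdom B n by exact: dual_fdom.
have -> : f (lift (z + y)) = f (OElt bF + lift z).
  apply: HBn_unif_class => //.
  by rewrite liftE raddfD unif_classD ?(valP (lift z)) //= liftE addrC yE.
rewrite fH // -{3}[z]liftE yE char_mod_unif_class ?(valP (lift z)) //.
by rewrite /rho_uperp udivE.
Qed.

Lemma phiB_intertwines (S : SpQ (bstar B) -> {linear V -> V}) (g : stabilizer B)
    (phi : qmod bo -> V) :
  phiB B n (Su S (pSp_bodd n g) phi) = SBn S g (phiB B n phi).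
Proof.
apply/funext => x; rewrite /phiB /Su /SBn /sigma ru_pSp_bodd; congr (S _ (phi _)).
apply: (can_inj (sp_funK (pSp_bodd n g))).
rewrite /= [LHS](sp_invK (pSp_bodd n g)).
have yF := valP (stab_actV g x).
by rewrite -[RHS](unif_class_stab g yF) /= sp_invK.
Qed.

(** * Supports and orbits *)

Hypotheses (char0 : [pchar k] =i pred0) (beta_sympl : is_psymplectic beta).

Lemma supp_Sp_orbit (x : omod_elt (fdom B n)) (phi : qmod bo -> V) :
  suppB (phiB B n phi) `<=` stab_orbit_mod B (\val x) ->
  supp phi `<=` Sp_orbit_mod (ucl (\val x)).
Proof.
move=> sub z; have [w wF ->] := unif_class_surj z => phiw.
have [|b bB [g gE]] := sub w; first by exists (OElt wF).
have bF : b \in fdom B n by exact: dual_fdom.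
exists (pSp_bodd n g), (ucl b); split; first by exists b.
have xF := valP x; rewrite -unif_class_stab // -gE -unif_classD ?subrK //.
exact: rpredB.
Qed.

Lemma suppB_stab_orbit (x : omod_elt (fdom B n)) (phi : qmod bo -> V) :
  \val x \notin Bd -> supp phi `<=` Sp_orbit_mod (ucl (\val x)) ->
  suppB (phiB B n phi) `<=` stab_orbit B (\val x).
Proof.
move=> xn sub _ [w <- /sub[g [y' [y'U wE]]]].
exact: Sp_orbit_lift (valP x) (valP w) xn y'U wE.
Qed.

Lemma stab_orbit_sub_mod x : stab_orbit B x `<=` stab_orbit_mod B x.
Proof. by move=> w wx; exists 0; rewrite ?rpred0 ?subr0. Qed.

Lemma suppB_stab_orbit_mod (x : omod_elt (fdom B n)) (phi : qmod bo -> V) :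
  supp phi `<=` Sp_orbit_mod (ucl (\val x)) ->
  suppB (phiB B n phi) `<=` stab_orbit_mod B (\val x).
Proof.
have [xB sub _ [w <- /sub[g [y' [y'U wE]]]]|xn sub] := boolP (\val x \in Bd); last first.
  apply: subset_trans (@stab_orbit_sub_mod _); exact: suppB_stab_orbit.
(* For [x] in [B^*], stability of [u^perp] forces [w] into [B^*], and then [w = x + (w - x)] lies in
   K_B x + B^*. *)
have xU : uperp (ucl (\val x)) by exists (\val x).
have [b bB bE] := uperp_stable g xU; have [c cB cE] := y'U.
have wB : \val w \in Bd.
  apply/(uperp_unif_class (valP w)); exists (b + c); first exact: rpredD.
  by rewrite unif_classD ?dual_fdom // -bE -cE.
exists (\val w - \val x); first by rewrite rpredB.
by rewrite opprB addrC subrK; apply: stab_orbit_refl.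
Qed.

End LatticeModel.

Unset Implicit Arguments.

Theorem mainTheorem9 (R : realType) (k : localFieldType)
    (char0 : [pchar k] =i pred0)
    (residue_char : 2%N \notin [pchar (residue_field k)])
    (pi : uniformizer k)
    (psi : k -> R[i]) (psi_char : unitary_character psi)
    (lam : int) (psi_cond : has_conductor psi lam)
    (r : nat) (W : vectType k) (dimW : \dim {:W} = (2 * r)%N)
    (beta : {skew_symmetric W}) (beta_sympl : is_psymplectic beta)
    (B : good_lattice pi beta lam)
    (V : lmodType R[i])
    (rho : heisenberg (bstar B) -> {linear V -> V})
    (rho_schrodinger : schrodinger_representation psi rho)
    (S : SpQ (bstar B) -> {linear V -> V})
    (S_weil : weil_representation rho S)
    (n : nat) :
  [/\ forall phi : qmod (bodd B n) -> V,
        Hn psi B n rho phi -> HBn psi B n rho (phiB B n phi),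
      [/\ forall (a : R[i]) (phi phi' : qmod (bodd B n) -> V),
            phiB B n (a *: phi + phi') = a *: phiB B n phi + phiB B n phi',
          set_bij (Hn psi B n rho) (HBn psi B n rho) (phiB B n)
        & forall (g : stabilizer B) (phi : qmod (bodd B n) -> V),
            Hn psi B n rho phi ->
            phiB B n (Su S (pSp_bodd n g) phi) = SBn S g (phiB B n phi)]
    & forall (x : omod_elt (fdom B n)) (phi : qmod (bodd B n) -> V),
        Hn psi B n rho phi ->
        (\val x \notin dual_omod beta lam B ->
           (suppB (phiB B n phi) `<=` stab_orbit B (\val x) <->
            supp phi `<=` Sp_orbit_mod (unif_class B n (\val x)))) /\
        (suppB (phiB B n phi) `<=` stab_orbit_mod B (\val x) <->
         supp phi `<=` Sp_orbit_mod (unif_class B n (\val x)))].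
Proof.
split; first by move=> phi; apply: phiB_HBn.
  split=> //; first exact: phiB_bij.
  by move=> g phi _; apply: phiB_intertwines.
move=> x phi _; split=> [xn|]; last first.
  by split; [exact: supp_Sp_orbit|exact: suppB_stab_orbit_mod].
split=> [sub|]; last exact: suppB_stab_orbit.
by apply: supp_Sp_orbit; apply: subset_trans sub (@stab_orbit_sub_mod _ _ _ _ _ _ _).
Qed.
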